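(* Let $\beta,\gamma$ be Hölder exponents, $T>0$, let $\rho_0\in\mathcal A_+$ be fixed, let $\rho$ be a solution of $(P)$ on $[0,T]\times\overline\Omega$ with initial datum $\rho_0$, and let $R:=\rho([0,T]\times\overline\Omega)\subset[0,\alpha]$. Assume $U\in C^{3+\gamma}(R)$, $\mathrm m^{(j)}\in C^{1+\gamma}(R)$ for $j=1,2$, $V\in C^{2+\gamma}(\overline\Omega)$, and that $\rho$ is of class $C^{1+\beta}$ in $t$ and $C^{2+\gamma}$ in $x$. If $\rho_i^n$ is the solution of the scheme $(P^\Delta)$, then $$\sup_{0\le n\le T/\Delta t}\Delta x\sum_{i\in I}|\rho_i^n-\rho(t_n,x_i)|\le C\big((\Delta t)^\beta+(\Delta x)^\gamma\big),$$ where $t_n=n\Delta t$ and $C$ is independent of $\Delta t,\Delta x$. Hence the numerical solution converges to the solution of the continuous problem as $\Delta=(\Delta t,\Delta x)\to0$.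
   Context: Setting. $\Omega=(0,1)$. Standing assumptions: (1) $\alpha\in(0,\infty)$, $\mathrm m\in C([0,\alpha])\cap C^1((0,\alpha))$, $\mathrm m(0)=\mathrm m(\alpha)=0$, $\mathrm m>0$ on $(0,\alpha)$; (2) $V\in C^2([0,1])$, $V\ge0$; (3) $U\in W^{1,1}((0,\alpha))\cap C^3((0,\alpha))$, $U''\ge0$, and $s_0\in(0,\alpha)$ is a fixed point with $U''(s_0)>0$; (4) $\mathrm m U''\in L^1(0,\alpha)$ and, with $\Phi(s):=\int_{s_0}^s\mathrm m(\tau)U''(\tau)\,d\tau$, one has $\Phi(0)<\Phi(s)<\Phi(\alpha)$ for $s\in(0,\alpha)$ and $$\sup_{s\in[0,\alpha]}\left|\tfrac{(\Phi(\alpha)-\Phi(s))\Phi(s)}{\Phi'(s)}\right|+\left|\tfrac{(\Phi(s)-\Phi(0))\Phi(s)}{\Phi'(s)}\right|<\infty .$$ $\mathcal A_+=\{\rho\in L^1(\Omega):\exists\delta>0,\ \delta\le\rho\le\alpha-\delta\}$. Problem $(P)$: $\partial_t\rho=\operatorname{div}(\mathrm m(\rho)\nabla(U'(\rho)+V))$ in $(0,\infty)\times\Omega$, no-flux condition $\mathrm m(\rho)\nabla(U'(\rho)+V)\cdot\nu=0$ on $(0,\infty)\times\partial\Omega$, $\rho(0,\cdot)=\rho_0$. Decomposition of the mobility. $\mathrm m=\mathrm m^{(1)}\mathrm m^{(2)}$ with $\mathrm m^{(j)}:[0,\alpha]\to[0,\infty)$ Lipschitz continuous, $\mathrm m^{(1)}$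 non-decreasing, $\mathrm m^{(2)}$ non-increasing. Scheme $(P^\Delta)$. Let $N\in\mathbb N$, $I=\{1,\dots,N\}$, $\Delta x=1/N$, $\Delta t>0$, $x_{i+1/2}=i\Delta x$, $x_i=(i-\frac12)\Delta x$. Initial condition $\rho_i^0=\frac1{\Delta x}\int_{x_{i-1/2}}^{x_{i+1/2}}\rho_0(x)\,dx$, and for $n\ge0$, $i\in I$, $$\frac{\rho_i^{n+1}-\rho_i^n}{\Delta t}=-\frac{F_{i+\frac12}(\rho^{n+1})-F_{i-\frac12}(\rho^{n+1})}{\Delta x},$$ $$F_{i+\frac12}(\rho)=\mathrm m^{(1)}(\rho_i)\mathrm m^{(2)}(\rho_{i+1})(v_{i+\frac12}(\rho))^++\mathrm m^{(1)}(\rho_{i+1})\mathrm m^{(2)}(\rho_i)(v_{i+\frac12}(\rho))^-,$$ $$v_{i+\frac12}(\rho)=-\frac{\xi_{i+1}(\rho)-\xi_i(\rho)}{\Delta x},\quad \xi_i(\rho)=U'(\rho_i)+V(x_i),\quad F_{\frac12}=F_{N+\frac12}=0,$$ with $u^+=\max(u,0)$, $u^-=\min(u,0)$. For initial data in $(0,\alpha)^{|I|}$ each step has a unique solution in $(0,\alpha)^{|I|}$. *)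

(* Defs.v *)
From HB Require Import structures.
From mathcomp Require Import all_boot all_order all_algebra.
From mathcomp Require Import all_classical all_reals all_analysis.

Set Implicit Arguments.
Unset Strict Implicit.
Unset Printing Implicit Defensive.

Import Order.TTheory GRing.Theory Num.Theory.
Import numFieldNormedType.Exports.
Local Open Scope ring_scope.
Local Open Scope classical_set_scope.

(* In [ring_scope] these notations denote derivatives of polynomials. *)
Local Notation "f ^` ()" := (derive1 f) : ring_scope.
Local Notation "f ^` ( n )" := (derive1n n f) : ring_scope.

Section derivative_within.
Variable R : realType.
Implicit Types (A : set R) (f g : R -> R).

(* Increments are restricted to those staying in [A]: at an endpoint of a
   closed interval the derivative is one-sided, and the values of [f] outside
   [A] are irrelevant. At an interior point of [A] it is the library
   derivative, see [derivn_in_open]. If [x] is isolated in [A], every number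
   is a derivative. *)
Definition diff_quot_in A f (x : R) : set_system R :=
  h^-1 * (f (h + x) - f x) @[h --> within [set h | A (h + x)] 0^'].

Definition has_deriv_in A f (x l : R) : Prop := diff_quot_in A f x --> l.

Definition derivable_in A f (x : R) : Prop := cvg (diff_quot_in A f x).

Definition deriv_in A f (x : R) : R := lim (diff_quot_in A f x).

Definition derivn_in A (k : nat) f : R -> R := iter k (deriv_in A) f.

Definition Ck_in A (k : nat) f : Prop :=
  (forall j x, (j < k)%N -> A x -> derivable_in A (derivn_in A j f) x) /\
  {within A, continuous (derivn_in A k f)}.

(* [f] belongs to C^{k+gamma}(A), with all the quantities entering its norm
   bounded by [K]. *)
Definition holder_norm_le A (k : nat) (gamma : R) f (K : R) : Prop :=
  [/\ forall j x, (j < k)%N -> A x -> derivable_in A (derivn_in A j f) x,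
      forall j x, (j <= k)%N -> A x -> `|derivn_in A j f x| <= K
    & forall x y, A x -> A y ->
        `|derivn_in A k f x - derivn_in A k f y| <= K * `|x - y| `^ gamma].

Definition Ck_holder A (k : nat) (gamma : R) f : Prop :=
  exists K, holder_norm_le A k gamma f K.

Lemma diff_quot_in_nbhs A f x : nbhs x A ->
  diff_quot_in A f x = (h^-1 *: (f (h + x) - f x) @[h --> 0^']).
Proof.
move=> Ax; rewrite /diff_quot_in.
suff -> : within [set h | A (h + x)] (0 : R)^' = 0^' by [].
have A0 : \forall h \near (0 : R)^', A (h + x).
  apply: cvg_within.
  have : (h + x) @[h --> (0 : R)] --> x.
    rewrite -[X in _ --> X]add0r.
    by apply: cvgD; [exact: cvg_id|exact: cvg_cst].
  exact.
rewrite eqEsubset; split => P; last exact: cvg_within.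
rewrite /within/= => AP; near=> h.
have : A (h + x) by near: h.
by near: h.
Unshelve. all: by end_near. Qed.

Lemma deriv_in_nbhs A f x : nbhs x A -> deriv_in A f x = f^`() x.
Proof. by move=> Ax; rewrite /deriv_in diff_quot_in_nbhs. Qed.

Lemma derivn_in_open A k f x : open A -> A x -> derivn_in A k f x = f^`(k) x.
Proof.
move=> oA; elim: k x => [//|k IH] x Ax.
have nA : nbhs x A by exact: open_nbhs_nbhs.
have -> : derivn_in A k.+1 f = deriv_in A (derivn_in A k f) by [].
rewrite (deriv_in_nbhs _ nA) derive1nS !derive1E; apply: near_eq_derive.
by near=> y; apply: IH; near: y.
Unshelve. all: by end_near. Qed.

End derivative_within.

Section lebesgue_sobolev.
Variable R : realType.
Local Notation mu := (@lebesgue_measure R).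

Definition L1_on (a b : R) (f : R -> R) : Prop :=
  mu.-integrable `]a, b[ (EFin \o f).

Definition test_function (a b : R) (phi : R -> R) : Prop :=
  [/\ forall k x, derivable (phi^`(k)) x 1,
      compact (closure [set x | phi x != 0])
    & closure [set x | phi x != 0] `<=` `]a, b[].

Definition W11 (a b : R) (f : R -> R) : Prop :=
  L1_on a b f /\
  exists2 g, L1_on a b g &
    forall phi, test_function a b phi ->
      \int[mu]_(x in `]a, b[) (f x * phi^`() x) =
      - \int[mu]_(x in `]a, b[) (g x * phi x).

Definition oriented_integral (a b : R) (f : R -> R) : R :=
  if a <= b then \int[mu]_(x in `]a, b[) f x
  else - \int[mu]_(x in `]b, a[) f x.

End lebesgue_sobolev.

Section problem.
Variable R : realType.
Local Notation mu := (@lebesgue_measure R).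
Variables (alpha : R) (m V U : R -> R).

Definition Phi (s0 s : R) : R :=
  oriented_integral s0 s (fun tau => m tau * U^`(2) tau).

(* In the last clause Phi' is taken relative to [0, alpha] and is required to
   be nonzero, since [x / 0 = 0]. In (0, alpha), Phi is always differentiable;
   at an endpoint where Phi' is not finite the quotients carry no condition. *)
Definition standing_assumptions (s0 : R) : Prop :=
  [/\ [/\ 0 < alpha, {within `[0, alpha], continuous m}, Ck_in `]0, alpha[ 1 m,
          m 0 = 0 /\ m alpha = 0
        & forall s, 0 < s < alpha -> 0 < m s],
      Ck_in `[0, 1] 2 V /\ (forall x, 0 <= x <= 1 -> 0 <= V x),
      [/\ W11 0 alpha U, Ck_in `]0, alpha[ 3 U,
          forall s, 0 < s < alpha -> 0 <= U^`(2) s,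
          0 < s0 < alpha
        & 0 < U^`(2) s0]
    & [/\ L1_on 0 alpha (fun s => m s * U^`(2) s),
          forall s, 0 < s < alpha -> Phi s0 0 < Phi s0 s < Phi s0 alpha
        & exists K, forall s, 0 <= s <= alpha ->
            let dPhi := deriv_in `[0, alpha] (Phi s0) s in
            derivable_in `[0, alpha] (Phi s0) s ->
            dPhi != 0 /\
            `|(Phi s0 alpha - Phi s0 s) * Phi s0 s / dPhi|
              + `|(Phi s0 s - Phi s0 0) * Phi s0 s / dPhi| <= K]].

Definition A_plus (rho0 : R -> R) : Prop :=
  L1_on 0 1 rho0 /\
  exists2 delta, 0 < delta &
    {ae mu, forall x, 0 < x < 1 -> delta <= rho0 x <= alpha - delta}.

(* U'(rho) + V, with U' one-sided where rho is 0 or alpha. *)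
Definition potential (rho : R -> R -> R) (t x : R) : R :=
  deriv_in `[0, alpha] U (rho t x) + V x.

Definition pde_flux (rho : R -> R -> R) (t x : R) : R :=
  m (rho t x) * deriv_in `[0, 1] (potential rho t) x.

Definition classical_solution (rho0 : R -> R) (T : R) (rho : R -> R -> R) :
    Prop :=
  [/\ forall t x, 0 <= t <= T -> 0 <= x <= 1 -> 0 <= rho t x <= alpha,
      forall t x, 0 < t <= T -> 0 <= x <= 1 ->
        derivable_in `[0, 1] (potential rho t) x,
      forall t x, 0 < t <= T -> 0 < x < 1 ->
        exists2 l, has_deriv_in `[0, T] (rho^~ x) t l &
                   has_deriv_in `[0, 1] (pde_flux rho t) x l,
      forall t, 0 < t <= T -> pde_flux rho t 0 = 0 /\ pde_flux rho t 1 = 0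
    & {ae mu, forall x, 0 < x < 1 -> rho 0 x = rho0 x}].

Definition mobility_decomposition (m1 m2 : R -> R) : Prop :=
  let I := `[0, alpha] : set R in
  [/\ forall s, I s -> m s = m1 s * m2 s,
      forall s, I s -> 0 <= m1 s /\ 0 <= m2 s,
      exists L, forall s t, I s -> I t ->
        `|m1 s - m1 t| <= L * `|s - t| /\ `|m2 s - m2 t| <= L * `|s - t|,
      forall s t, I s -> I t -> s <= t -> m1 s <= m1 t
    & forall s t, I s -> I t -> s <= t -> m2 t <= m2 s].

End problem.

(* Cells are numbered 1, ..., N and interface [i] stands for x_{i+1/2}. A grid
   function is a map [nat -> R] of which only the values at 1, ..., N matter. *)
Section scheme.
Variable R : realType.
Local Notation mu := (@lebesgue_measure R).
Variables (alpha : R) (V U m1 m2 : R -> R) (N : nat) (dt : R).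

Definition dx : R := N%:R^-1.
Definition interface (i : nat) : R := i%:R * dx.
Definition center (i : nat) : R := (i%:R - 2^-1) * dx.

Definition cell_average (f : R -> R) (i : nat) : R :=
  dx^-1 * \int[mu]_(x in `[interface i.-1, interface i]) f x.

Definition xi (u : nat -> R) (i : nat) : R := U^`() (u i) + V (center i).

Definition velocity (u : nat -> R) (i : nat) : R := - (xi u i.+1 - xi u i) / dx.

Definition num_flux (u : nat -> R) (i : nat) : R :=
  if (i == 0)%N || (i == N) then 0
  else m1 (u i) * m2 (u i.+1) * Num.max (velocity u i) 0
       + m1 (u i.+1) * m2 (u i) * Num.min (velocity u i) 0.

Definition scheme_solution (rho0 : R -> R) (r : nat -> nat -> R) : Prop :=
  forall i, (1 <= i <= N)%N ->
    [/\ r 0 i = cell_average rho0 i,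
        forall n, 0 < r n i < alpha
      & forall n, (r n.+1 i - r n i) / dt =
                  - (num_flux (r n.+1) i - num_flux (r n.+1) i.-1) / dx].

Definition L1_error (rho : R -> R -> R) (r : nat -> nat -> R) (n : nat) : R :=
  dx * \sum_(1 <= i < N.+1) `|r n i - rho (n%:R * dt) (center i)|.

Definition sup_error (T : R) (rho : R -> R -> R) (r : nat -> nat -> R) :
    \bar R :=
  ereal_sup [set (L1_error rho r n)%:E | n in [set n | n%:R <= T / dt]].

End scheme.

(* Main.v *)
Require Import Defs.
From HB Require Import structures.
From mathcomp Require Import all_boot all_order all_algebra.
From mathcomp Require Import all_classical all_reals all_analysis.
From mathcomp Require Import ring lra.

Set Implicit Arguments.
Unset Strict Implicit.
Unset Printing Implicit Defensive.

Import Order.TTheory GRing.Theory Num.Theory.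
Import numFieldNormedType.Exports.
Local Open Scope ring_scope.
Local Open Scope classical_set_scope.

(** The flux of the scheme through an interface is increasing in the density on
its left and decreasing in the density on its right, because [m1] and U' are
increasing and [m2] is decreasing ([upwind_le]). An implicit time step is
therefore a contraction in L^1: when the equations of two grid functions are
subtracted and summed against the signs of the differences, the flux terms have
a sign ([abs_sum_contraction]). One of the two grid functions is the numerical
solution, the other one samples the exact solution at the grid points and
satisfies the scheme up to a truncation error. Each step thus increases the
L^1 error by at most [dt] times the L^1 norm of the truncation error, and
there are at most T / dt steps ([error_step], [L1_error_bound]).

In an interior cell the truncation error is O(dt^beta + dx^gamma)
([truncation_error], [truncation_bound]). The positive and negative parts of
the velocity are only Lipschitz, but they enter the difference of two
neighbouring fluxes with coefficients that agree up to O(dx), so that their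
increments cost O(dx^2), while their sum is the velocity itself and
reassembles the derivative of the exact flux ([upwind_difference_expansion]).
The remaining term is a second difference of the potential U'(rho) + V, whose
second derivative is Hoelder continuous. In the two boundary cells the no-flux
condition keeps the truncation error bounded; this suffices, since these cells
have total weight 2 dx <= 2 dx^gamma in the L^1 norm.

The smoothness of U, m1, m2 refers to derivatives relative to the range of the
solution, whereas U' in the equation is relative to [0, alpha]. Unless the
solution is constant, every point of the range is a limit point of it
([range_dichotomy]), and the range contains a one-sided neighbourhood of 0 or
alpha as soon as it contains that endpoint, because the initial datum stays
away from both ([range_near0], [range_near_alpha]). Hence the two derivatives
agree on the range ([dU_range]), and the monotonicity of U' extends to the
endpoints by continuity ([dU_range_monotone]). *)

(** * Derivatives relative to a set *)

Section one_sided_calculus.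
Variable R : realType.
Implicit Types (A B : set R) (f g : R -> R) (a b x y l k e d r : R).

(** The increment is multiplied out, so that nothing is divided by an increment
that vanishes: at an isolated point of [A] every [l] qualifies, and the chain
rule holds for arbitrary sets. *)
Definition diff_in A f x l := forall e : R, 0 < e -> exists2 d : R, 0 < d &
  forall y, A y -> `|y - x| < d -> `|f y - f x - l * (y - x)| <= e * `|y - x|.

Lemma has_deriv_inP A f x l : has_deriv_in A f x l <-> diff_in A f x l.
Proof.
split.
- move=> /cvgrPdist_le H e e0; move: (H e e0).
  move=> /nbhs_ballP[d /= d0 Hd].
  exists d => // y Ay yx.
  have [->|yxE] := eqVneq y x; first by rewrite !subrr mulr0 subrr normr0 mulr0.
  have yx0 : y - x != 0 by rewrite subr_eq0.
  have := Hd (y - x); rewrite /ball/= sub0r normrN => /(_ yx yx0).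
  rewrite /= subrK => /(_ Ay) K.
  have -> : f y - f x - l * (y - x) =
            - (l - (y - x)^-1 * (f y - f x)) * (y - x) by field.
  by rewrite normrM normrN ler_wpM2r.
- move=> H; apply/cvgrPdist_le => e e0; have [d d0 Hd] := H e e0.
  apply/nbhs_ballP; exists d => //= h.
  rewrite /ball/= sub0r normrN => hd h0 Ahx.
  have := Hd (h + x) Ahx; rewrite addrK => /(_ hd) K.
  have -> : l - h^-1 * (f (h + x) - f x) =
            - (f (h + x) - f x - l * h) / h by field.
  by rewrite normrM normrN normfV ler_pdivrMr ?normr_gt0.
Qed.

Lemma deriv_inP A f x : derivable_in A f x -> diff_in A f x (deriv_in A f x).
Proof. by move=> Df; apply/has_deriv_inP. Qed.

Lemma diff_in_sub A B f x l : B `<=` A -> diff_in A f x l -> diff_in B f x l.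
Proof.
move=> BA H e /H[d d0 Hd]; exists d => // y By; apply: Hd; exact: BA.
Qed.

(** At an endpoint reached by the solution, this turns a derivative relative to
the range into a derivative relative to [0, alpha]. *)
Lemma diff_in_near A B f x l r : 0 < r ->
  (forall y, `|y - x| < r -> B y -> A y) -> diff_in A f x l -> diff_in B f x l.
Proof.
move=> r0 BA H e /H[d d0 Hd]; exists (Num.min d r); first by rewrite lt_min d0.
by move=> y By; rewrite lt_min => /andP[yd yr]; apply: Hd => //; apply: BA.
Qed.

Lemma diff_in_eq A f g x l : (forall y, A y -> f y = g y) -> A x ->
  diff_in A f x l -> diff_in A g x l.
Proof.
move=> fg Ax H e /H[d d0 Hd]; exists d => // y Ay yx.
by rewrite -!fg//; exact: Hd.
Qed.

Lemma diff_in_cst A x k : diff_in A (fun=> k) x 0.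
Proof.
move=> e e0; exists 1 => // y _ _.
by rewrite subrr mul0r subrr normr0 mulr_ge0// ltW.
Qed.

Lemma diff_inD A f g x l k : diff_in A f x l -> diff_in A g x k ->
  diff_in A (fun y => f y + g y) x (l + k).
Proof.
move=> Hf Hg e e0; have e20 : 0 < e / 2 by rewrite divr_gt0.
have [d d0 Hd] := Hf _ e20; have [d' d0' Hd'] := Hg _ e20.
exists (Num.min d d'); first by rewrite lt_min d0.
move=> y Ay; rewrite lt_min => /andP[yd yd'].
have -> : f y + g y - (f x + g x) - (l + k) * (y - x) =
  (f y - f x - l * (y - x)) + (g y - g x - k * (y - x)) by ring.
rewrite (le_trans (ler_normD _ _))// (splitr e) mulrDl.
by rewrite lerD ?Hd ?Hd'.
Qed.

Lemma diff_in_lip A f x l : diff_in A f x l -> exists2 d : R, 0 < d &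
  forall y, A y -> `|y - x| < d -> `|f y - f x| <= (`|l| + 1) * `|y - x|.
Proof.
move=> /(_ 1 ltr01)[d d0 Hd]; exists d => // y Ay yx.
rewrite -[f y - f x](subrK (l * (y - x))) (le_trans (ler_normD _ _))//.
by rewrite addrC mulrDl lerD// ?normrM// Hd.
Qed.

Lemma diff_in_comp A B f g x l k : (forall y, A y -> B (g y)) ->
  diff_in B f (g x) l -> diff_in A g x k ->
  diff_in A (fun y => f (g y)) x (l * k).
Proof.
move=> AB Hf Hg e e0; have [dl dl0 Hl] := diff_in_lip Hg.
have k1 : 0 < `|k| + 1 by rewrite ltr_wpDl.
have l1 : 0 < `|l| + 1 by rewrite ltr_wpDl.
have e20 : 0 < e / 2 by rewrite divr_gt0.
have [d d0 Hd] := Hf _ (divr_gt0 e20 k1).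
have [d' d'0 Hd'] := Hg _ (divr_gt0 e20 l1).
exists (Num.min (Num.min dl d') (d / (`|k| + 1))).
  by rewrite !lt_min dl0 d'0 divr_gt0.
move=> y Ay; rewrite !lt_min => /andP[/andP[yl yd'] yd].
have gy : `|g y - g x| <= (`|k| + 1) * `|y - x| by exact: Hl.
have gd : `|g y - g x| < d.
  by rewrite (le_lt_trans gy)// mulrC -ltr_pdivlMr.
have -> : f (g y) - f (g x) - l * k * (y - x) =
  (f (g y) - f (g x) - l * (g y - g x)) + l * (g y - g x - k * (y - x)) by ring.
rewrite (le_trans (ler_normD _ _))// (splitr e) mulrDl lerD//.
  apply: (le_trans (Hd _ (AB _ Ay) gd)).
  by rewrite -mulrA ler_wpM2l ?(ltW e20)// ler_pdivrMl.
rewrite normrM (le_trans (ler_wpM2l (normr_ge0 _) (Hd' _ Ay yd')))//.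
rewrite mulrA ler_wpM2r// mulrA ler_pdivrMr// mulrC ler_wpM2l ?(ltW e20)//.
by rewrite lerDl.
Qed.

Lemma diff_in_affine A x k r : diff_in A (fun y => k * y + r) x k.
Proof.
move=> e e0; exists 1 => // y _ _.
have -> : k * y + r - (k * x + r) - k * (y - x) = 0 by ring.
by rewrite normr0 mulr_ge0// ltW.
Qed.

Lemma diff_inZ A f x k l : diff_in A f x l ->
  diff_in A (fun y => k * f y) x (k * l).
Proof.
move=> Hf; have := diff_in_comp (fun _ _ => Logic.I)
  (@diff_in_affine setT (f x) k 0) Hf.
by congr diff_in; apply/funext => y; rewrite addr0.
Qed.

Lemma diff_inB A f g x l k : diff_in A f x l -> diff_in A g x k ->
  diff_in A (fun y => f y - g y) x (l - k).
Proof.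
move=> Hf Hg; have := diff_inD Hf (diff_inZ (-1) Hg).
by rewrite mulN1r; congr diff_in; apply/funext => y; rewrite mulN1r.
Qed.

Lemma diff_inM A f g x l k : diff_in A f x l -> diff_in A g x k ->
  diff_in A (fun y => f y * g y) x (l * g x + f x * k).
Proof.
move=> Hf Hg.
have sq h j :
    diff_in A h x j -> diff_in A (fun y => h y * h y) x ((2 * h x) * j).
  move=> Hh; apply: (@diff_in_comp _ setT (fun z => z * z)) => // e e0.
  exists e => // y _ ye.
  have -> : y * y - h x * h x - 2 * h x * (y - h x) =
    (y - h x) * (y - h x) by ring.
  by rewrite normrM ler_wpM2r// ltW.
(* polarization: f g = ((f + g)^2 - f^2 - g^2) / 2 *)
have := diff_inZ 2^-1 (diff_inB
  (diff_inB (sq _ _ (diff_inD Hf Hg)) (sq _ _ Hf)) (sq _ _ Hg)).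
by congr diff_in; [apply/funext => y; field|field].
Qed.

Lemma diff_in_uniq A f x l k :
  (forall e : R, 0 < e -> exists y, A y /\ 0 < `|y - x| < e) ->
  diff_in A f x l -> diff_in A f x k -> l = k.
Proof.
move=> Ax Hl Hk; apply/eqP; rewrite eq_le; apply/andP.
suff H a b : diff_in A f x a -> diff_in A f x b -> a <= b by split; exact: H.
move=> Ha Hb; apply/ler_addgt0Pl => e e0.
have e20 : 0 < e / 2 by rewrite divr_gt0.
have [d d0 Hd] := Ha _ e20; have [d' d'0 Hd'] := Hb _ e20.
have [|y [Ay /andP[y0]]] := Ax (Num.min d d'); first by rewrite lt_min d0.
rewrite lt_min => /andP[yd yd']; have := Hd y Ay yd; have := Hd' y Ay yd'.
move=> K1 K2; rewrite -lerBlDr -(ler_pM2r y0).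
apply: (le_trans (y := `|(a - b) * (y - x)|)).
  by rewrite normrM ler_wpM2r// ler_norm.
have -> : (a - b) * (y - x) =
  (f y - f x - b * (y - x)) - (f y - f x - a * (y - x)) by ring.
by apply: (le_trans (ler_normB _ _)); lra.
Qed.

Lemma itv_limit_point a b x : a < b -> a <= x <= b ->
  forall e : R, 0 < e -> exists y, `[a, b] y /\ 0 < `|y - x| < e.
Proof.
move=> ab /andP[ax xb] e e0.
have [xlt|xge] := ltP x b.
- exists (Num.min b (x + e / 2)).
  have [h|h] := leP b (x + e / 2).
    rewrite /= in_itv/= lexx (ltW ab)/= gtr0_norm ?subr_gt0// xlt.
    by split=> //; lra.
  rewrite /= in_itv/= (ltW h) addrAC subrr add0r gtr0_norm ?divr_gt0//.
  by split; [apply/andP; split => //; lra|lra].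
- exists (Num.max a (x - e / 2)).
  have [h|h] := leP a (x - e / 2).
    rewrite /= in_itv/= h addrAC subrr add0r normrN gtr0_norm ?divr_gt0//.
    by split; [lra|lra].
  rewrite /= in_itv/= lexx (ltW ab)/= ltr0_norm ?subr_lt0; last by lra.
  by split; [|lra].
Qed.

Lemma diff_in_cont A f f1 :
  (forall x, A x -> diff_in A f x (f1 x)) -> {within A, continuous f}.
Proof.
move=> Hf; apply/subspace_continuousP => x Ax.
apply/cvgrPdist_le => e e0; have [d d0 Hd] := diff_in_lip (Hf x Ax).
have l1 : 0 < `|f1 x| + 1 by rewrite ltr_wpDl.
apply/nbhs_ballP; exists (Num.min d (e / (`|f1 x| + 1))) => /=.
  by rewrite lt_min d0 divr_gt0.
move=> y; rewrite /ball/= distrC lt_min => /andP[yd ye] Ay.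
rewrite distrC (le_trans (Hd y Ay yd))// mulrC -ler_pdivlMr//; exact: ltW.
Qed.

Lemma diff_in_is_derive A f x l : nbhs x A -> diff_in A f x l ->
  is_derive x 1 f l.
Proof.
move=> nA /has_deriv_inP; rewrite /has_deriv_in diff_quot_in_nbhs// => H.
have E : (fun h : R => h^-1 *: (f (h + x) - f x)) =
         (fun h : R => h^-1 *: (f (h *: (1 : R) + x) - f x)).
  by apply/funext => h; rewrite [h *: _]mulr1.
rewrite E in H.
apply: DeriveDef; first by apply/cvg_ex; exists l; exact: H.
exact: cvg_lim.
Qed.

(** In the interior of the segment the relative derivative is the ordinary one,
so the mean value theorem for continuous functions applies. *)
Lemma diff_in_MVT a b f f1 : a <= b ->
  (forall x, a <= x <= b -> diff_in `[a, b] f x (f1 x)) ->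
  exists2 c, a <= c <= b & f b - f a = f1 c * (b - a).
Proof.
move=> ab Hf; have [||c] := @MVT_segment R f f1 a b ab.
- move=> x xab; apply: (@diff_in_is_derive `[a, b]).
    apply: filterS (near_in_itvoo xab) => y /=; rewrite !in_itv/=.
    by move=> /andP[/ltW -> /ltW ->].
  by apply: Hf; move: xab; rewrite in_itv/= => /andP[/ltW -> /ltW ->].
- by apply: (@diff_in_cont _ _ f1) => x; rewrite /= in_itv/=; exact: Hf.
- by rewrite in_itv/= => cab E; exists c.
Qed.

End one_sided_calculus.

(** * The monotone flux and the L^1 contraction *)

Section upwind_scheme.
Variable R : realType.
Implicit Types (v w e : nat -> R) (lam dt : R).

(** The mobilities upwind of a velocity [v]: with densities p on the left and q
on the right, [a] = m1 p, [b] = m2 q, [c] = m1 q and [d] = m2 p. *)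
Definition upwind (a b c d v : R) := a * b * Num.max v 0 + c * d * Num.min v 0.

(** The part of [v] that is negative multiplies [c] and [d], which is why the
order of these two coefficients is reversed. *)
Lemma upwind_le (a b c d v a' b' c' d' v' : R) :
  0 <= a <= a' -> 0 <= b <= b' -> 0 <= c' <= c -> 0 <= d' <= d -> v <= v' ->
  upwind a b c d v <= upwind a' b' c' d' v'.
Proof.
move=> /andP[a0 aa] /andP[b0 bb] /andP[c0 cc] /andP[d0 dd] vv.
have max0 (x : R) : 0 <= Num.max x 0 by rewrite le_max lexx orbT.
have min0 (x : R) : Num.min x 0 <= 0 by rewrite ge_min lexx orbT.
have maxv : Num.max v 0 <= Num.max v' 0.
  by rewrite ge_max !le_max vv lexx orbT.
have minv : Num.min v 0 <= Num.min v' 0.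
  by rewrite le_min !ge_min vv lexx orbT.
rewrite /upwind lerD//; first by rewrite !ler_pM// mulr_ge0.
by rewrite -lerN2 -!mulrN !ler_pM ?mulr_ge0 ?oppr_ge0 ?lerN2.
Qed.

(** The equation for [w] is multiplied by the sign of [w i] and summed. In the
summation by parts [G i] comes with the factor sg (w i) - sg (w i.+1), which
vanishes unless the sign changes, and then has the sign of [G i]. *)
Lemma abs_sum_contraction (N : nat) lam dt w w0 G e :
  0 <= lam -> 0 <= dt -> G 0%N = 0 -> G N = 0 ->
  (forall i, (1 <= i < N)%N -> w i.+1 <= 0 <= w i -> 0 <= G i) ->
  (forall i, (1 <= i < N)%N -> w i <= 0 <= w i.+1 -> G i <= 0) ->
  (forall i, (1 <= i <= N)%N ->
     w i = w0 i - lam * (G i - G i.-1) - dt * e i) ->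
  \sum_(1 <= i < N.+1) `|w i| <=
  \sum_(1 <= i < N.+1) `|w0 i| + dt * \sum_(1 <= i < N.+1) `|e i|.
Proof.
move=> lam0 dt0 G0 GN Gpos Gneg wE.
(* the last term is the boundary term of the partial summation by parts *)
suff H : forall k, (k <= N)%N ->
    \sum_(1 <= i < k.+1) `|w i| + lam * (Num.sg (w k) * G k) <=
    \sum_(1 <= i < k.+1) `|w0 i| + dt * \sum_(1 <= i < k.+1) `|e i|.
  by have := H N (leqnn N); rewrite GN !mulr0 addr0.
elim=> [_|k IH kN]; first by rewrite !big_geq// G0 !mulr0 addr0.
have {}IH := IH (ltnW kN).
rewrite !(big_nat_recr k.+1)//= mulrDr.
have step : `|w k.+1| + lam * (Num.sg (w k.+1) * (G k.+1 - G k)) <=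
            `|w0 k.+1| + dt * `|e k.+1|.
  have -> : `|w k.+1| + lam * (Num.sg (w k.+1) * (G k.+1 - G k)) =
            Num.sg (w k.+1) * (w0 k.+1 - dt * e k.+1).
    by rewrite normrEsg {2}(wE k.+1)//=; ring.
  rewrite (le_trans (ler_norm _))// normrM.
  have -> : dt * `|e k.+1| = `|dt * e k.+1| by rewrite normrM (ger0_norm dt0).
  rewrite (le_trans _ (ler_normB _ _))// ler_piMl// normr_sg.
  by case: (_ != _).
suff mon : 0 <= lam * ((Num.sg (w k) - Num.sg (w k.+1)) * G k) by lra.
rewrite mulr_ge0//; case: k {IH step} kN => [_|k kN]; first by rewrite G0 mulr0.
have p : w k.+2 <= 0 -> 0 <= w k.+1 -> 0 <= G k.+1.
  by move=> h1 h2; apply: Gpos; rewrite // h1.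
have n : w k.+1 <= 0 -> 0 <= w k.+2 -> G k.+1 <= 0.
  by move=> h1 h2; apply: Gneg; rewrite // h1.
move: (G k.+1) p n => g p n.
case: (sgrP (w k.+1)) => w1; case: (sgrP (w k.+2)) => w2;
  rewrite ?subrr ?mul0r//.
all: try have := p ltac:(lra) ltac:(lra).
all: try have := n ltac:(lra) ltac:(lra).
all: by move=> *; lra.
Qed.

End upwind_scheme.

(** * Truncation error of the upwind flux for smooth profiles *)

Section truncation.
Variable R : realType.
Implicit Types (f g a b : R -> R) (x y z h c : R).

Definition holder_on (gamma K : R) f :=
  (forall x, 0 <= x <= 1 -> `|f x| <= K) /\
  (forall x y, 0 <= x <= 1 -> 0 <= y <= 1 ->
     `|f x - f y| <= K * `|x - y| `^ gamma).

Definition diff_on01 f f1 :=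
  forall x, 0 <= x <= 1 -> diff_in `[0, 1] f x (f1 x).

Lemma diff_on01_sub f f1 x y z : diff_on01 f f1 -> 0 <= x -> y <= 1 ->
  x <= z <= y -> diff_in `[x, y] f z (f1 z).
Proof.
move=> Hf x0 y1 xzy; apply: (@diff_in_sub _ `[0, 1]).
  by move=> u; rewrite /= !in_itv/=; lra.
by apply: Hf; lra.
Qed.

Lemma diff_on01_MVT f f1 x y : diff_on01 f f1 -> 0 <= x <= 1 -> 0 <= y <= 1 ->
  exists c, [/\ 0 <= c <= 1, `|c - x| <= `|y - x| & f y - f x = f1 c * (y - x)].
Proof.
move=> Hf /andP[x0 x1] /andP[y0 y1].
have [xy|/ltW yx] := leP x y.
- have [c cxy E] := diff_in_MVT xy (fun z => diff_on01_sub Hf x0 y1).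
  exists c; split => //; first lra.
  by rewrite !ger0_norm; lra.
- have [c cxy E] := diff_in_MVT yx (fun z => diff_on01_sub Hf y0 x1).
  exists c; split; first lra.
    by rewrite !ler0_norm; lra.
  by rewrite -opprB E -mulrN opprB.
Qed.

Lemma holder_bound_ge0 gamma K f : holder_on gamma K f -> 0 <= K.
Proof. by case=> H _; apply: le_trans (H 0 _); rewrite ?lexx ?ler01. Qed.

Lemma taylor1 gamma K f f1 x y :
  0 < gamma -> diff_on01 f f1 -> holder_on gamma K f1 ->
  0 <= x <= 1 -> 0 <= y <= 1 ->
  `|f y - f x - f1 x * (y - x)| <= K * (`|y - x| * `|y - x| `^ gamma).
Proof.
move=> g0 Df Hf x01 y01; have [c [c01 cx ->]] := diff_on01_MVT Df x01 y01.
rewrite -mulrBl normrM mulrCA mulrC ler_wpM2l//.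
apply: (le_trans (Hf.2 _ _ c01 x01)).
rewrite ler_wpM2l ?(holder_bound_ge0 Hf)//.
by rewrite ge0_ler_powR ?nnegrE// ltW.
Qed.

Lemma lip_of_bounded K f f1 x y : diff_on01 f f1 ->
  (forall z, 0 <= z <= 1 -> `|f1 z| <= K) -> 0 <= x <= 1 -> 0 <= y <= 1 ->
  `|f y - f x| <= K * `|y - x|.
Proof.
move=> Df Hf x01 y01; have [c [c01 cx ->]] := diff_on01_MVT Df x01 y01.
by rewrite normrM ler_wpM2r// Hf.
Qed.

(** Mean values of y |-> g (y + h) - g y and then of [g1] use no derivative
beyond the second, so that the Hoelder bound on [g2] gives the full order
h^(2 + gamma). *)
Lemma second_difference g g1 g2 x h : 0 < h -> 0 <= x - h -> x + h <= 1 ->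
  diff_on01 g g1 -> diff_on01 g1 g2 ->
  exists z, [/\ 0 <= z <= 1, `|z - x| <= h &
    (g (x + h) - g x) - (g x - g (x - h)) = h * h * g2 z].
Proof.
move=> h0 xh0 xh1 Dg Dg1.
have Dpsi y : x - h <= y <= x ->
    diff_in `[x - h, x] (fun y => g (y + h) - g y) y (g1 (y + h) - g1 y).
  move=> yx; apply: diff_inB; last by apply: (diff_on01_sub Dg); lra.
  rewrite -[g1 _]mulr1; apply: (@diff_in_comp _ _ `[0, 1] g (fun y => y + h)).
  - by move=> u; rewrite /= !in_itv/=; lra.
  - by apply: Dg; lra.
  - have := @diff_in_affine _ `[x - h, x] y 1 h.
    by congr diff_in; apply/funext => u; rewrite mul1r.
have [|c cxh E] := diff_in_MVT _ Dpsi; first lra.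
have [|z|z zc E'] := @diff_in_MVT _ c (c + h) g1 g2; first lra.
  by apply: diff_on01_sub => //; lra.
exists z; split; first lra.
  by rewrite ler_norml; lra.
by move: E; rewrite E' subrK => ->; ring.
Qed.

Lemma max0_lip (u v : R) : `|Num.max u 0 - Num.max v 0| <= `|u - v|.
Proof.
by rewrite ler_norml; case: (ger0P (u - v)); case: (lerP u 0);
  case: (lerP v 0); lra.
Qed.

Lemma min0_lip (u v : R) : `|Num.min u 0 - Num.min v 0| <= `|u - v|.
Proof.
by rewrite ler_norml; case: (ger0P (u - v)); case: (lerP u 0);
  case: (lerP v 0); lra.
Qed.

Lemma max0_min0 (u : R) : Num.max u 0 + Num.min u 0 = u.
Proof. by rewrite addr_max_min addr0. Qed.

Lemma max0_norm (u : R) : `|Num.max u 0| <= `|u|.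
Proof. by have := max0_lip u 0; rewrite maxxx !subr0. Qed.

Lemma min0_norm (u : R) : `|Num.min u 0| <= `|u|.
Proof. by have := min0_lip u 0; rewrite minxx !subr0. Qed.

(** The velocity between the grid points [x] and [x + h]. *)
Definition slope g h x := - (g (x + h) - g x) / h.

Definition grid_flux a b g h x :=
  upwind (a x) (b (x + h)) (a (x + h)) (b x) (slope g h x).


(** The two fluxes have the coefficients a bp, ap b and am b, a bm. Up to O(w),
their differences from a b are b1 a h, a1 b h, - a1 b h and - b1 a h. In the
difference of the fluxes the four parts of the velocities are compared with
those of - g1; as max (- g1) 0 and min (- g1) 0 add up to - g1, the four
first-order terms combine into - h (a b)' g1, and each replacement costs
h * O(h). *)
Lemma upwind_difference_expansion
    (K h w a b a1 b1 g1 g2 ap bp am bm vp vm : R) :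
  0 <= h -> h * h <= w ->
  `|a| <= K -> `|b| <= K -> `|a1| <= K -> `|b1| <= K ->
  `|vp| <= K -> `|vm| <= K ->
  `|ap - a - a1 * h| <= K * w -> `|bp - b - b1 * h| <= K * w ->
  `|am - a + a1 * h| <= K * w -> `|bm - b + b1 * h| <= K * w ->
  `|vp + g1| <= K * h -> `|vm + g1| <= K * h -> `|vp - vm + h * g2| <= K * w ->
  `|upwind a bp ap b vp - upwind am b a bm vm
    + h * ((a1 * b + a * b1) * g1 + a * b * g2)| <= 9 * (K * K * (K * w)).
Proof.
move=> h0 hw aK bK a1K b1K vpK vmK.
set e2 := ap - a - _; set e1 := bp - b - _.
set e3 := am - a + _; set e4 := bm - b + _.
move=> e2K e1K e3K e4K vpg vmg vg.
have K0 : 0 <= K := le_trans (normr_ge0 _) aK.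
have mul3 x y z : `|x| <= K -> `|y| <= K -> `|z| <= K * w ->
    - (K * K * (K * w)) <= x * y * z <= K * K * (K * w).
  by move=> xK yK zK; rewrite -ler_norml !normrM !ler_pM ?mulr_ge0.
have hD (u v : R) : `|u - v| <= K * h -> `|h * (u - v)| <= K * w.
  move=> uv; rewrite normrM (ger0_norm h0) (le_trans (ler_wpM2l h0 uv))//.
  by rewrite mulrCA ler_wpM2l.
have vpg' : `|vp - - g1| <= K * h by rewrite opprK.
have vmg' : `|vm - - g1| <= K * h by rewrite opprK.
have T1 := mul3 _ _ _ aK bK vg.
have T2 := mul3 _ _ _ aK b1K (hD _ _ (le_trans (max0_lip _ _) vpg')).
have T3 := mul3 _ _ _ aK b1K (hD _ _ (le_trans (min0_lip _ _) vmg')).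
have T4 := mul3 _ _ _ a1K bK (hD _ _ (le_trans (min0_lip _ _) vpg')).
have T5 := mul3 _ _ _ a1K bK (hD _ _ (le_trans (max0_lip _ _) vmg')).
have T6 := mul3 _ _ _ aK (le_trans (max0_norm _) vpK) e1K.
have T7 := mul3 _ _ _ bK (le_trans (min0_norm _) vpK) e2K.
have T8 := mul3 _ _ _ bK (le_trans (max0_norm _) vmK) e3K.
have T9 := mul3 _ _ _ aK (le_trans (min0_norm _) vmK) e4K.
have Ep := max0_min0 vp; have Em := max0_min0 vm; have E0 := max0_min0 (- g1).
have expand pp np pm nm p0 n0 :
  pp + np = vp -> pm + nm = vm -> p0 + n0 = - g1 ->
  a * bp * pp + ap * b * np - (am * b * pm + a * bm * nm)
    + h * ((a1 * b + a * b1) * g1 + a * b * g2) =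
  a * b * (vp - vm + h * g2)
  + a * b1 * (h * (pp - p0)) + a * b1 * (h * (nm - n0))
  + a1 * b * (h * (np - n0)) + a1 * b * (h * (pm - p0))
  + a * pp * e1 + b * np * e2 - b * pm * e3 - a * nm * e4.
  move=> <- <- E; have -> : g1 = - (p0 + n0) by rewrite E opprK.
  by rewrite /e1 /e2 /e3 /e4; ring.
rewrite /upwind (expand _ _ _ _ _ _ Ep Em E0).
by rewrite ler_norml; lra.
Qed.

Lemma prod3_lip (K d x y z x' y' z' : R) :
  `|x| <= K -> `|y| <= K -> `|z| <= K ->
  `|x'| <= K -> `|y'| <= K -> `|z'| <= K ->
  `|x - x'| <= d -> `|y - y'| <= d -> `|z - z'| <= d ->
  `|x * y * z - x' * y' * z'| <= 3 * (K * K * d).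
Proof.
move=> xK yK zK xK' yK' zK' dx dy dz.
have mul3 u v w : `|u| <= K -> `|v| <= K -> `|w| <= d ->
    - (K * K * d) <= u * v * w <= K * K * d.
  by move=> uK vK wd; rewrite -ler_norml !normrM !ler_pM ?mulr_ge0.
have T1 := mul3 _ _ _ yK zK dx; have T2 := mul3 _ _ _ xK' zK dy.
have T3 := mul3 _ _ _ xK' yK' dz.
have -> : x * y * z - x' * y' * z' =
  y * z * (x - x') + x' * z * (y - y') + x' * y' * (z - z') by ring.
by rewrite ler_norml; lra.
Qed.

Section smooth_profile.
Variables (gamma K : R) (a a1 b b1 g g1 g2 : R -> R).
Hypotheses (gamma01 : 0 < gamma <= 1).
Hypotheses (Da : diff_on01 a a1) (Db : diff_on01 b b1).
Hypotheses (Dg : diff_on01 g g1) (Dg1 : diff_on01 g1 g2).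
Hypotheses (Ha : holder_on gamma K a) (Hb : holder_on gamma K b).
Hypotheses (Ha1 : holder_on gamma K a1) (Hb1 : holder_on gamma K b1).
Hypotheses (Hg1 : holder_on gamma K g1) (Hg2 : holder_on gamma K g2).

Let gamma0 : 0 < gamma. Proof. by case/andP: gamma01. Qed.

Let K0 : 0 <= K. Proof. exact: holder_bound_ge0 Ha. Qed.

Lemma slope_mean_value h x : 0 < h -> 0 <= x -> x + h <= 1 ->
  exists2 c, x <= c <= x + h & slope g h x = - g1 c.
Proof.
move=> h0 x0 xh; have [||c cx E] := @diff_in_MVT _ x (x + h) g g1.
- by lra.
- by move=> z; exact: diff_on01_sub.
exists c => //; rewrite /slope E (_ : x + h - x = h); last by ring.
by rewrite -mulNr mulfK ?gt_eqF.
Qed.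

Lemma slope_approx h x z r : 0 < h -> 0 <= x -> x + h <= 1 -> 0 <= z <= 1 ->
  x + h - r <= z <= x + r -> `|slope g h x + g1 z| <= K * r.
Proof.
move=> h0 x0 xh z01 zx; have [c cx ->] := slope_mean_value h0 x0 xh.
have c01 : 0 <= c <= 1 by lra.
rewrite addrC (le_trans (lip_of_bounded Dg1 Hg2.1 c01 z01))// ler_wpM2l//.
by rewrite ler_norml; lra.
Qed.

Lemma slope_bounded h x : 0 < h -> 0 <= x -> x + h <= 1 -> `|slope g h x| <= K.
Proof.
move=> h0 x0 xh; have [c cx ->] := slope_mean_value h0 x0 xh.
by rewrite normrN Hg1.1//; lra.
Qed.

Lemma le_powR_unit (h : R) : 0 < h <= 1 -> h <= h `^ gamma.
Proof.
move=> h01; have /andP[h0 _] := h01; rewrite -{1}(powRr1 (ltW h0)).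
by apply: ger_powR => //; case/andP: gamma01.
Qed.

(** The derivative of a b g1; the upwind flux approximates - a b g1. *)
Definition flux_deriv x := (a1 x * b x + a x * b1 x) * g1 x + a x * b x * g2 x.

Lemma flux_difference_consistent h x : 0 < h -> 0 <= x - h -> x + h <= 1 ->
  `|grid_flux a b g h x - grid_flux a b g h (x - h)
    + h * flux_deriv x|
  <= 9 * (K * K * (K * (h * h `^ gamma))).
Proof.
move=> h0 xh0 xh1.
have x01 : 0 <= x <= 1 by lra.
have p01 : 0 <= x + h <= 1 by lra.
have m01 : 0 <= x - h <= 1 by lra.
have h1 : 0 < h <= 1 by lra.
have nh : `|x + h - x| = h by rewrite (_ : _ - x = h) ?gtr0_norm//; ring.
have nh' : `|x - h - x| = h.
  by rewrite (_ : _ - x = - h) ?normrN ?gtr0_norm//; ring.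
rewrite /grid_flux subrK; apply: upwind_difference_expansion.
- exact: ltW.
- by rewrite ler_wpM2l ?le_powR_unit// ltW.
- exact: Ha.1.
- exact: Hb.1.
- exact: Ha1.1.
- exact: Hb1.1.
- by apply: slope_bounded => //; lra.
- by apply: slope_bounded => //; lra.
- have := taylor1 gamma0 Da Ha1 x01 p01; rewrite nh.
  by rewrite (_ : x + h - x = h)//; ring.
- have := taylor1 gamma0 Db Hb1 x01 p01; rewrite nh.
  by rewrite (_ : x + h - x = h)//; ring.
- have := taylor1 gamma0 Da Ha1 x01 m01; rewrite nh'.
  by rewrite (_ : x - h - x = - h) ?mulrN ?opprK//; ring.
- have := taylor1 gamma0 Db Hb1 x01 m01; rewrite nh'.
  by rewrite (_ : x - h - x = - h) ?mulrN ?opprK//; ring.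
- by apply: slope_approx => //; lra.
- by apply: slope_approx => //; lra.
- have [z [z01 zx E]] := second_difference h0 xh0 xh1 Dg Dg1.
  have -> : slope g h x - slope g h (x - h) + h * g2 x = h * (g2 x - g2 z).
    rewrite /slope subrK; move: E; set A := g (x + h) - g x.
    set B := g x - g (x - h) => E.
    have -> : - A / h - - B / h = - (A - B) / h by ring.
    by rewrite E; field; rewrite gt_eqF.
  rewrite normrM (gtr0_norm h0) mulrCA ler_wpM2l ?(ltW h0)//.
  rewrite (le_trans (Hg2.2 _ _ x01 z01))// ler_wpM2l//.
  by rewrite ge0_ler_powR ?nnegrE ?(ltW gamma0) ?(ltW h0)// distrC.
Qed.

(** First-order accuracy at any point [z] near the interface. With [z] on the
boundary, where the exact flux vanishes, it bounds the only flux of a boundary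
cell by O(h). *)
Lemma flux_consistent h x z : 0 < h -> 0 <= x -> x + h <= 1 -> 0 <= z <= 1 ->
  `|z - x| <= 2 * h ->
  `|grid_flux a b g h x + a z * b z * g1 z| <= 18 * (K * K * (K * h)).
Proof.
move=> h0 x0 xh z01; rewrite ler_norml => zx.
have x01 : 0 <= x <= 1 by lra.
have p01 : 0 <= x + h <= 1 by lra.
have near f f1 y : diff_on01 f f1 -> holder_on gamma K f1 ->
    0 <= y <= 1 -> `|y - z| <= 3 * h -> `|f y - f z| <= K * (3 * h).
  move=> Df Hf y01 yz; rewrite (le_trans (lip_of_bounded Df Hf.1 z01 y01))//.
  by rewrite ler_wpM2l.
have xz3 : `|x - z| <= 3 * h by rewrite ler_norml; lra.
have xhz3 : `|x + h - z| <= 3 * h by rewrite ler_norml; lra.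
have vz : `|slope g h x - - g1 z| <= K * (3 * h).
  by rewrite opprK slope_approx//; lra.
have gz : `|- g1 z| <= K by rewrite normrN Hg1.1.
have vK := slope_bounded h0 x0 xh.
have T1 : `|a x * b (x + h) * Num.max (slope g h x) 0
            - a z * b z * Num.max (- g1 z) 0| <= 3 * (K * K * (K * (3 * h))).
  apply: prod3_lip; rewrite ?(Ha.1 _) ?(Hb.1 _)//.
  - exact: le_trans (max0_norm _) _.
  - exact: le_trans (max0_norm _) _.
  - exact: near Da Ha1 _ _.
  - exact: near Db Hb1 _ _.
  - exact: le_trans (max0_lip _ _) _.
have T2 : `|a (x + h) * b x * Num.min (slope g h x) 0
            - a z * b z * Num.min (- g1 z) 0| <= 3 * (K * K * (K * (3 * h))).
  apply: prod3_lip; rewrite ?(Ha.1 _) ?(Hb.1 _)//.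
  - exact: le_trans (min0_norm _) _.
  - exact: le_trans (min0_norm _) _.
  - exact: near Da Ha1 _ _.
  - exact: near Db Hb1 _ _.
  - exact: le_trans (min0_lip _ _) _.
have -> : grid_flux a b g h x + a z * b z * g1 z =
  (a x * b (x + h) * Num.max (slope g h x) 0
   - a z * b z * Num.max (- g1 z) 0)
  + (a (x + h) * b x * Num.min (slope g h x) 0
     - a z * b z * Num.min (- g1 z) 0).
  have E := max0_min0 (- g1 z); rewrite /grid_flux /upwind.
  have -> : a z * b z * g1 z =
    - (a z * b z * (Num.max (- g1 z) 0 + Num.min (- g1 z) 0)).
    by rewrite E; ring.
  by ring.
rewrite (le_trans (ler_normD _ _))//.
by rewrite (le_trans (lerD T1 T2))// le_eqVlt; apply/orP; left; apply/eqP; ring.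
Qed.

Section grid.
Variable N : nat.
Hypothesis N_gt0 : (0 < N)%N.
Let h := dx R N.

Definition cell_flux i :=
  if (i == 0)%N || (i == N) then 0 else grid_flux a b g h (Defs.center R N i).

Let h0 : 0 < h. Proof. by rewrite invr_gt0 ltr0n. Qed.

Let Nh : N%:R * h = 1. Proof. by rewrite mulfV// pnatr_eq0 -lt0n. Qed.

(** In a boundary cell only one of the two fluxes is present. Its quotient by [h]
is bounded because the exact flux vanishes on the boundary; the indicators
record this weaker bound. *)
Lemma truncation_error i : (1 <= i <= N)%N ->
  a 0 * b 0 * g1 0 = 0 -> a 1 * b 1 * g1 1 = 0 ->
  `|(cell_flux i - cell_flux i.-1) / h + flux_deriv (Defs.center R N i)| <=
  21 * (K * K * K) * (h `^ gamma + (i == 1%N)%:R + (i == N)%:R).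
Proof.
move=> /andP[i1 iN] bd0 bd1; set x := Defs.center R N i.
set D := flux_deriv x.
have hp : 0 <= h `^ gamma by exact: powR_ge0.
have hN : i%:R * h <= 1 by rewrite -[leRHS]Nh ler_wpM2r ?ler_nat// ltW.
have hi : h <= i%:R * h by rewrite ler_peMl ?ler1n// ltW.
have xE : x = i%:R * h - h / 2 by rewrite /x /Defs.center -/h; ring.
have x01 : 0 <= x <= 1 by move: h0; lra.
have DK : `|D| <= 3 * (K * K * K).
  have m3 u v w : `|u| <= K -> `|v| <= K -> `|w| <= K ->
      - (K * K * K) <= u * v * w <= K * K * K.
    by move=> uK vK wK; rewrite -ler_norml !normrM !ler_pM ?mulr_ge0.
  have T1 := m3 _ _ _ (Ha1.1 _ x01) (Hb.1 _ x01) (Hg1.1 _ x01).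
  have T2 := m3 _ _ _ (Ha.1 _ x01) (Hb1.1 _ x01) (Hg1.1 _ x01).
  have T3 := m3 _ _ _ (Ha.1 _ x01) (Hb.1 _ x01) (Hg2.1 _ x01).
  by rewrite /D /flux_deriv ler_norml; lra.
have K3 : 0 <= K * K * K by rewrite !mulr_ge0.
have flux_i : i != N -> x + h <= 1 /\ cell_flux i = grid_flux a b g h x.
  move=> iN'; rewrite /cell_flux (negPf iN') -[i == 0]negbK -lt0n i1/=.
  split=> //; have : i.+1%:R * h <= 1.
    by rewrite -[leRHS]Nh ler_wpM2r ?ler_nat ?ltn_neqAle ?iN'// ltW.
  by rewrite -natr1; move: h0; lra.
have flux_p : i != 1%N ->
    0 <= x - h /\ cell_flux i.-1 = grid_flux a b g h (x - h).
  move=> i1'; have i2 : (1 < i)%N by rewrite ltn_neqAle eq_sym i1'.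
  rewrite /cell_flux; case: (i) i2 hi xE iN => [//|[//|j]] _ hi xE iN.
  rewrite /= ltn_eqF//.
  have -> : Defs.center R N j.+1 = x - h.
    by rewrite xE /Defs.center -/h -!natr1; field.
  split=> //; rewrite xE (_ : j.+2%:R = j%:R + 2); last by rewrite -addn2 natrD.
  have : 0 <= j%:R * h by rewrite mulr_ge0// ltW.
  by move: h0; lra.
have bd y z : 0 <= y -> y + h <= 1 -> 0 <= z <= 1 -> `|z - y| <= 2 * h ->
    a z * b z * g1 z = 0 -> `|grid_flux a b g h y / h| <= 18 * (K * K * K).
  move=> y0 yh z01 zy E; rewrite normrM normfV (gtr0_norm h0) ler_pdivrMr//.
  by have := flux_consistent h0 y0 yh z01 zy; rewrite E addr0 -!mulrA.
have [i1E|i1N] := eqVneq i 1%N; have [iNE|iNN] := eqVneq i N.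
- rewrite {1}/cell_flux iNE eqxx orbT -iNE i1E /= /cell_flux/=.
  rewrite subrr mul0r add0r.
  rewrite (le_trans DK)//; nra.
- have [xh ->] := flux_i iNN; rewrite i1E /= {1}/cell_flux/= subr0.
  rewrite (le_trans (ler_normD _ _))//.
  have := bd x 0; rewrite !(lexx, ler01)/= => /(_ _ xh isT _ bd0) T.
  have {}T : `|grid_flux a b g h x / h| <= 18 * (K * K * K).
    apply: T; first by case/andP: x01.
    by rewrite sub0r normrN ger0_norm xE i1E; move: h0; lra.
  nra.
- have [xh ->] := flux_p i1N; rewrite {1}/cell_flux iNE eqxx orbT sub0r mulNr.
  rewrite (le_trans (ler_normD _ _))// normrN.
  have := bd (x - h) 1; rewrite !(lexx, ler01)/= => /(_ xh _ isT _ bd1) T.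
  have {}T : `|grid_flux a b g h (x - h) / h| <= 18 * (K * K * K).
    apply: T; first by lra.
    by rewrite xE iNE Nh ler_norml; move: h0; lra.
  nra.
- have [xh ->] := flux_i iNN; have [xh' ->] := flux_p i1N.
  have T := flux_difference_consistent h0 xh' xh.
  rewrite !addr0 -(ler_pM2r h0) -[X in _ * X <= _](gtr0_norm h0) -normrM.
  rewrite mulrDl divfK ?gt_eqF//.
  rewrite [D * h]mulrC (le_trans T)//.
  have : 0 <= K * K * K * (h `^ gamma * h) by rewrite mulr_ge0// mulr_ge0// ltW.
  lra.
Qed.

End grid.

End smooth_profile.

End truncation.

(** * Hoelder bounds uniform in a parameter *)

Section uniform_families.
Variables (R : realType) (I : Type) (S : set I) (gamma : R).
Hypothesis gamma01 : 0 < gamma <= 1.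
Implicit Types (f g : I -> R -> R).

(** The parameter is the time: the constant in the error estimate has to be the
same for all time levels. *)
Definition unif_holder f := exists K, forall t, S t -> holder_on gamma K (f t).

Definition unif_diff f f1 := forall t, S t -> diff_on01 (f t) (f1 t).

Lemma holder_on_le (K L : R) (f : R -> R) : K <= L -> holder_on gamma K f ->
  holder_on gamma L f.
Proof.
move=> KL [H1 H2]; split=> [x x01|x y x01 y01].
  exact: le_trans (H1 _ x01) KL.
by rewrite (le_trans (H2 _ _ x01 y01))// ler_wpM2r// powR_ge0.
Qed.

Lemma unif_holderD f g : unif_holder f -> unif_holder g ->
  unif_holder (fun t x => f t x + g t x).
Proof.
move=> [K HK] [L HL]; exists (K + L) => t St.
have [F1 F2] := HK t St; have [G1 G2] := HL t St; split=> [x x01|x y x01 y01].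
  by rewrite (le_trans (ler_normD _ _))// lerD ?F1 ?G1.
have -> : f t x + g t x - (f t y + g t y) =
  (f t x - f t y) + (g t x - g t y) by ring.
by rewrite (le_trans (ler_normD _ _))// mulrDl lerD ?F2 ?G2.
Qed.

Lemma unif_holderM f g : unif_holder f -> unif_holder g ->
  unif_holder (fun t x => f t x * g t x).
Proof.
move=> [K HK] [L HL]; exists (2 * `|K| * `|L|) => t St.
have [F1 F2] := holder_on_le (ler_norm K) (HK t St).
have [G1 G2] := holder_on_le (ler_norm L) (HL t St).
split=> [x x01|x y x01 y01].
  rewrite normrM (le_trans (ler_pM _ _ (F1 _ x01) (G1 _ x01)))// -mulrA.
  have : 0 <= `|K| * `|L| by rewrite mulr_ge0.
  lra.
have -> : f t x * g t x - f t y * g t y =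
  (f t x - f t y) * g t x + f t y * (g t x - g t y) by ring.
rewrite (le_trans (ler_normD _ _))// !normrM.
have := ler_pM (normr_ge0 _) (normr_ge0 _) (F2 _ _ x01 y01) (G1 _ x01).
have := ler_pM (normr_ge0 _) (normr_ge0 _) (F1 _ y01) (G2 _ _ x01 y01).
lra.
Qed.

(** On [0, 1] distances are at most 1, so a Lipschitz function is Hoelder
continuous of every exponent gamma <= 1. *)
Lemma unif_holder_of_diff f f1 K L : unif_diff f f1 ->
  (forall t x, S t -> 0 <= x <= 1 -> `|f t x| <= K) ->
  (forall t x, S t -> 0 <= x <= 1 -> `|f1 t x| <= L) -> unif_holder f.
Proof.
move=> Df HK HL; exists (`|K| + `|L|) => t St; split=> [x x01|x y x01 y01].
  by rewrite (le_trans (HK t x St x01))// (le_trans (ler_norm _))// lerDl.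
rewrite (le_trans (lip_of_bounded (Df t St) (HL t ^~ St) y01 x01))//.
have [->|xy] := eqVneq x y.
  by rewrite subrr normr0 mulr0 mulr_ge0// powR_ge0.
rewrite (le_trans (ler_wpM2r (normr_ge0 _) (ler_norm L)))//.
rewrite ler_pM// ?lerDr// le_powR_unit// normr_gt0 subr_eq0 xy/=.
by rewrite ler_norml; lra.
Qed.

Lemma unif_holder_comp (B : set R) (phi : R -> R) f K L :
  (forall t x, S t -> 0 <= x <= 1 -> B (f t x)) ->
  (forall s, B s -> `|phi s| <= K) ->
  (forall s s', B s -> B s' -> `|phi s - phi s'| <= K * `|s - s'| `^ gamma) ->
  (forall t x y, S t -> 0 <= x <= 1 -> 0 <= y <= 1 ->
     `|f t x - f t y| <= L * `|x - y|) ->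
  unif_holder (fun t x => phi (f t x)).
Proof.
move=> fB HK Hphi Hf; exists (`|K| * (1 + `|L| `^ gamma)) => t St.
have [g0 g1] := andP gamma01.
split=> [x x01|x y x01 y01].
  rewrite (le_trans (HK _ (fB _ _ St x01)))// (le_trans (ler_norm _))//.
  by rewrite ler_peMr// lerDl powR_ge0.
rewrite (le_trans (Hphi _ _ (fB _ _ St x01) (fB _ _ St y01)))//.
rewrite (le_trans (ler_wpM2r (powR_ge0 _ _) (ler_norm K)))// -mulrA ler_wpM2l//.
rewrite mulrDl mul1r ler_wpDl ?powR_ge0// -powRM//.
rewrite ge0_ler_powR ?nnegrE ?mulr_ge0 ?(ltW g0)//.
by rewrite (le_trans (Hf t x y St x01 y01))// ler_wpM2r// ler_norm.
Qed.

End uniform_families.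

(** * Derivatives in Hoelder classes, intermediate values *)

Section holder_norm.
Variable R : realType.
Implicit Types (A B : set R) (f : R -> R).

Lemma holder_norm_diff_in A k (gamma K : R) f j x :
  holder_norm_le A k gamma f K -> (j < k)%N -> A x ->
  diff_in A (derivn_in A j f) x (derivn_in A j.+1 f x).
Proof. by move=> [H _ _] jk Ax; apply/deriv_inP/H. Qed.

Lemma Ck_in_diff_in A k f j x : Ck_in A k f -> (j < k)%N -> A x ->
  diff_in A (derivn_in A j f) x (derivn_in A j.+1 f x).
Proof. by move=> [H _] jk Ax; apply/deriv_inP/H. Qed.

Lemma holder_normP k (gamma K : R) f j : holder_norm_le `[0, 1] k gamma f K ->
  (j < k)%N -> diff_on01 (derivn_in `[0, 1] j f) (derivn_in `[0, 1] j.+1 f).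
Proof.
by move=> H jk x x01; apply: holder_norm_diff_in H jk _; rewrite /= in_itv.
Qed.

Lemma diff_in_deriv_in A f x l : 
  (forall e : R, 0 < e -> exists y, A y /\ 0 < `|y - x| < e) ->
  diff_in A f x l -> deriv_in A f x = l.
Proof.
move=> Ax Dl; apply: (diff_in_uniq Ax _ Dl).
by apply/deriv_inP/cvg_ex; exists l; exact/has_deriv_inP.
Qed.

Lemma diff_on01_deriv_in f f1 x : diff_on01 f f1 -> 0 <= x <= 1 ->
  deriv_in `[0, 1] f x = f1 x.
Proof.
move=> Df x01; apply: diff_in_deriv_in (Df _ x01).
exact: itv_limit_point ltr01 x01.
Qed.

Lemma holder_norm_bound A k (gamma K : R) f j x :
  holder_norm_le A k gamma f K -> (j <= k)%N -> A x -> `|derivn_in A j f x| <= K.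
Proof. by move=> [_ H _]; exact: H. Qed.

Lemma holder_norm_top A k (gamma K : R) f : holder_norm_le A k gamma f K ->
  forall x y, A x -> A y ->
  `|derivn_in A k f x - derivn_in A k f y| <= K * `|x - y| `^ gamma.
Proof. by case. Qed.

Lemma ivt_itv a b f (p q v : R) : {within `[a, b], continuous f} ->
  a <= p <= b -> a <= q <= b -> f p <= v <= f q ->
  exists2 c, a <= c <= b & f c = v.
Proof.
move=> cf apb aqb pvq.
have sub x y : a <= x -> y <= b -> {within `[x, y], continuous f}.
  move=> ax yb; apply: continuous_subspaceW cf => u; rewrite /= !in_itv/=; lra.
have [pq|/ltW qp] := leP p q.
- have [||c] := @IVT R f p q v pq; first by apply: sub; lra.
    by rewrite ge_min le_max; move/andP: pvq => [-> ->]; rewrite orbT.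
  by rewrite in_itv/= => cpq; exists c => //; lra.
- have [||c] := @IVT R f q p v qp; first by apply: sub; lra.
    by rewrite ge_min le_max; move/andP: pvq => [-> ->]; rewrite orbT.
  by rewrite in_itv/= => cpq; exists c => //; lra.
Qed.

(** By the intermediate value theorem a continuous function that takes a second
value takes values arbitrarily close to f p. *)
Lemma isolated_value_constant a b f (p e : R) :
  {within `[a, b], continuous f} -> 0 < e -> a <= p <= b ->
  (forall x, a <= x <= b -> `|f x - f p| < e -> f x = f p) ->
  forall x, a <= x <= b -> f x = f p.
Proof.
move=> cf e0 apb H x axb; apply: contrapT => /eqP neq.
have [lt|gt] : f p < f x \/ f x < f p.
  by case/orP: (lt_total neq) => ?; [right|left].
- pose v := Num.min (f x) (f p + e / 2).
  have [vx vp] : v <= f x /\ v <= f p + e / 2.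
    by rewrite /v !ge_min !lexx orbT.
  have pv : f p < v by rewrite /v lt_min lt/=; lra.
  have [|c acb E] := @ivt_itv a b f p x v cf apb axb; first lra.
  have := H c acb; rewrite E ltr_norml => K; have : v = f p by apply: K; lra.
  lra.
- pose v := Num.max (f x) (f p - e / 2).
  have [vx vp] : f x <= v /\ f p - e / 2 <= v.
    by rewrite /v !le_max !lexx orbT.
  have pv : v < f p by rewrite /v gt_max gt/=; lra.
  have [|c acb E] := @ivt_itv a b f x p v cf axb apb; first lra.
  have := H c acb; rewrite E ltr_norml => K; have : v = f p by apply: K; lra.
  lra.
Qed.

End holder_norm.

(** * Monotonicity of U' up to the endpoints *)

Section derivative_of_energy.
Variables (R : realType) (alpha : R) (U : R -> R).
Hypothesis CU : Ck_in `]0, alpha[ 3 U.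
Hypothesis U_convex : forall s : R, 0 < s < alpha -> 0 <= derive1n 2 U s.

Local Notation dU := (deriv_in `[0, alpha] U).

Lemma itvooE (s : R) : `]0, alpha[ s = (0 < s < alpha) :> Prop.
Proof. by rewrite /= in_itv. Qed.

Lemma dU_interior s : 0 < s < alpha -> dU s = derive1 U s.
Proof.
move=> s0a; apply: deriv_in_nbhs.
have sI : s \in `]0, alpha[%R by rewrite in_itv.
apply: filterS (near_in_itvoo sI) => y /=.
by rewrite !in_itv/= => /andP[/ltW -> /ltW ->].
Qed.

Lemma dU_diff_in s : 0 < s < alpha -> diff_in `]0, alpha[ dU s (derive1n 2 U s).
Proof.
move=> s0a; have As : `]0, alpha[ s by rewrite itvooE.
have oA : open (`]0, alpha[ : set R) by exact: interval_open.
rewrite -(derivn_in_open 2 U oA As).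
apply: (@diff_in_eq _ _ (derivn_in `]0, alpha[ 1 U)) => //.
  by move=> y Ay; rewrite (derivn_in_open 1 U oA Ay) dU_interior// -itvooE.
exact: Ck_in_diff_in CU _ _.
Qed.

Lemma dU_monotone p q : 0 < p -> p <= q -> q < alpha -> dU p <= dU q.
Proof.
move=> p0 pq qa.
have [|c cpq E] := @diff_in_MVT _ p q dU (derive1n 2 U) pq.
  move=> x xpq; apply: (@diff_in_sub _ `]0, alpha[).
    by move=> u; rewrite /= !in_itv/=; lra.
  by apply: dU_diff_in; lra.
by rewrite -subr_ge0 E mulr_ge0 ?U_convex//; lra.
Qed.

(** U' is differentiable, hence continuous, relative to [A] at 0, so its value
there is a limit of values U'(s) <= U'(p) with s > 0. *)
Lemma dU_monotone_left A p l : diff_in A dU 0 l -> (forall r, 0 < r ->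
    exists2 s, A s & 0 < s < r) -> 0 < p < alpha -> dU 0 <= dU p.
Proof.
move=> D0 A0 /andP[p0 pa]; apply/ler_addgt0Pl => e e0.
have [d d0 Hd] := diff_in_lip D0; have l1 : 0 < `|l| + 1 by rewrite ltr_wpDl.
have [|s As /andP[s0]] := A0 (Num.min (Num.min d p) (e / (`|l| + 1))).
  by rewrite !lt_min d0 p0 divr_gt0.
rewrite !lt_min => /andP[/andP[sd sp] se].
have := Hd s As; rewrite subr0 gtr0_norm// => /(_ sd).
have : (`|l| + 1) * s <= e by rewrite mulrC -ler_pdivlMr// ltW.
have := dU_monotone s0 (ltW sp) pa; rewrite ler_norml; lra.
Qed.

Lemma dU_monotone_right A p l : diff_in A dU alpha l -> (forall r, 0 < r ->
    exists2 s, A s & alpha - r < s < alpha) ->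
  0 < p < alpha -> dU p <= dU alpha.
Proof.
move=> D0 A0 /andP[p0 pa]; apply/ler_addgt0Pl => e e0.
have [d d0 Hd] := diff_in_lip D0; have l1 : 0 < `|l| + 1 by rewrite ltr_wpDl.
have [|s As /andP[sr sa]] :=
  A0 (Num.min (Num.min d (alpha - p)) (e / (`|l| + 1))).
  by rewrite !lt_min d0 subr_gt0 pa divr_gt0.
have : alpha - s < Num.min (Num.min d (alpha - p)) (e / (`|l| + 1)) by lra.
rewrite !lt_min => /andP[/andP[sd sp] se].
have := Hd s As; rewrite distrC gtr0_norm ?subr_gt0// => /(_ sd).
have : (`|l| + 1) * (alpha - s) <= e by rewrite mulrC -ler_pdivlMr// ltW.
have := @dU_monotone p s p0; rewrite ler_norml; lra.
Qed.

End derivative_of_energy.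

(** * Almost everywhere bounds and cell averages *)

Section ae_bounds.
Variable R : realType.
Local Notation mu := (@lebesgue_measure R).

Lemma ae_itv_exists (P : R -> Prop) (a b : R) :
  a < b -> {ae mu, forall x, P x} ->
  exists2 x, a < x < b & P x.
Proof.
move=> ab [N [mN N0 PN]]; apply: contrapT => H.
have sub : `]a, b[ `<=` N.
  move=> x; rewrite /= in_itv/= => xab; apply: PN => Px; apply: H.
  by exists x.
have : (mu `]a, b[ <= mu N)%E by apply: le_measure => //; rewrite inE.
rewrite N0 lebesgue_measure_itv/= lte_fin ab -EFinB lee_fin.
by rewrite subr_le0 leNgt ab.
Qed.

End ae_bounds.

Section cell_averages.
Variable R : realType.
Local Notation mu := (@lebesgue_measure R).

Lemma Rintegral_near_cst (p q c e : R) (f : R -> R) : p < q ->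
  mu.-integrable `]p, q[ (EFin \o f) ->
  {ae mu, forall x, p < x < q -> `|f x - c| <= e} ->
  `|\int[mu]_(x in `[p, q]) f x - c * (q - p)| <= e * (q - p).
Proof.
move=> pq intf aef; set D : set (measurableTypeR R) := `]p, q[.
have mD : measurable D by exact: measurable_itv.
have muD : mu D = (q - p)%:E by rewrite lebesgue_measure_itv/= lte_fin pq EFinB.
have intc : mu.-integrable D (EFin \o (fun=> c)).
  apply: measurable_bounded_integrable => //.
    by have := ltry (q - p); rewrite -muD.
  by exists `|c|; split; rewrite ?num_real// => y cy x _ /=; exact: ltW.
have intB := integrableB mD intf intc.
have -> : \int[mu]_(x in `[p, q]) f x = \int[mu]_(x in D) f x.
  by rewrite /Rintegral integral_itv_bndoo//; case/integrableP: intf.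
have -> : c * (q - p) = \int[mu]_(x in D) (fun=> c) x.
  by rewrite (@Rintegral_cst _ _ _ mu)// -[q - p]/(fine (q - p)%:E) -muD.
rewrite -RintegralB// -lee_fin EFin_normr_Rintegral//.
have /integrableP[mB _] := intB.
apply: le_trans (le_abse_integral _ mD mB) _.
apply: (@le_trans _ _ (\int[mu]_(x in D) (cst e%:E) x)%E); last first.
  by rewrite integral_cst// EFinM -muD.
have e0 : 0 <= e.
  have [x xpq /(_ xpq)] := ae_itv_exists pq aef; exact: le_trans.
apply: ae_ge0_le_integral => //.
by case/integrableP: (integrable_abse intB).
Qed.

End cell_averages.

(** * The range of the solution *)

Section range_of_solution.
Variable R : realType.
Local Notation mu := (@lebesgue_measure R).

Lemma ae_bounds_closed (f f1 : R -> R) (a b : R) : diff_on01 f f1 ->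
  {ae mu, forall x, 0 < x < 1 -> a <= f x <= b} ->
  forall x, 0 <= x <= 1 -> a <= f x <= b.
Proof.
move=> Df ae x x01.
suff near e : 0 < e -> exists y, a <= f y <= b /\ `|f y - f x| <= e.
  by apply/andP; split; apply/ler_addgt0Pl => e /near[y []];
    rewrite ler_norml; lra.
move=> e0; have xin : `[0, 1]%classic x by rewrite /= in_itv.
have [d d0 Hd] := diff_in_lip (Df x x01).
have l1 : 0 < `|f1 x| + 1 by rewrite ltr_wpDl.
pose r := Num.min d (e / (`|f1 x| + 1)).
have r0 : 0 < r by rewrite lt_min d0 divr_gt0.
have [|y] := @ae_itv_exists R _ (Num.max 0 (x - r)) (Num.min 1 (x + r)) _ ae.
  by rewrite gt_max !lt_min; apply/andP; split; apply/andP; split; lra.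
rewrite gt_max lt_min => /andP[/andP[y0 yxr] /andP[y1 yrx]] H.
exists y; split; first by apply: H; rewrite y0.
have yr : `|y - x| < r by rewrite ltr_norml; lra.
move: (yr); rewrite /r lt_min => /andP[yd ye].
have /Hd : `[0, 1]%classic y by rewrite /= in_itv/= (ltW y0) (ltW y1).
move=> /(_ yd) /le_trans; apply.
by rewrite mulrC -ler_pdivlMr// ltW.
Qed.

Variables (alpha T : R) (rho : R -> R -> R).
Hypothesis T_gt0 : 0 < T.
Hypothesis rho_range :
  forall t x : R, 0 <= t <= T -> 0 <= x <= 1 -> 0 <= rho t x <= alpha.
Hypothesis rho_cont_t :
  forall x : R, 0 <= x <= 1 -> {within `[0, T], continuous (rho^~ x)}.
Hypothesis rho_cont_x :
  forall t : R, 0 <= t <= T -> {within `[0, 1], continuous (rho t)}.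

Let Rg := [set rho t x | t in `[0, T] & x in `[0, 1]].

Lemma in_range t x : 0 <= t <= T -> 0 <= x <= 1 -> Rg (rho t x).
Proof.
by move=> tT x01; exists t; rewrite /= ?in_itv//; exists x; rewrite /= ?in_itv.
Qed.

(** If a value is isolated in the range, then by connectedness it is taken at all
times at one place, and then at each time everywhere. *)
Lemma range_dichotomy :
  (forall t x, 0 <= t <= T -> 0 <= x <= 1 -> rho t x = rho 0 0) \/
  (forall s, Rg s -> forall e : R, 0 < e -> exists y, Rg y /\ 0 < `|y - s| < e).
Proof.
have [H|H] := pselect (forall s, Rg s -> forall e : R, 0 < e ->
  exists y, Rg y /\ 0 < `|y - s| < e); [by right|left].
have [s [[t0] /=]] : exists s, Rg s /\ exists e : R, 0 < e /\
    forall y, Rg y -> `|y - s| < e -> y = s.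
  apply: contrapT => K; apply: H => s Rs e e0; apply: contrapT => K'.
  apply: K; exists s; split=> //; exists e; split=> // y Ry ye.
  apply: contrapT => ys; apply: K'; exists y; split=> //.
  by rewrite normr_gt0 subr_eq0 ye andbT; exact/eqP.
rewrite in_itv/= => t0T [x0 /=]; rewrite in_itv/= => x01 <- [e [e0 iso]].
have E t : 0 <= t <= T -> rho t x0 = rho t0 x0.
  move=> tT.
  apply: (isolated_value_constant (rho_cont_t x01) e0 t0T) => // t' t'T.
  by apply: iso; exact: in_range.
have E' t x : 0 <= t <= T -> 0 <= x <= 1 -> rho t x = rho t0 x0.
  move=> tT xx; rewrite -(E t tT).
  apply: (isolated_value_constant (rho_cont_x tT) e0 x01) => // y y01.
  by rewrite (E t tT); apply: iso; exact: in_range.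
by move=> t x tT xx; rewrite !E' ?lexx ?ler01 ?(ltW T_gt0).
Qed.

Variable delta : R.
Hypothesis delta_gt0 : 0 < delta.
Hypothesis rho_init :
  forall x : R, 0 <= x <= 1 -> delta <= rho 0 x <= alpha - delta.

(** If the solution vanishes at time t and place x, then t |-> rho t x runs
through all values between that zero and its initial value. *)
Lemma range_near0 : Rg 0 -> forall s, 0 <= s <= delta -> Rg s.
Proof.
move=> [t /=]; rewrite in_itv/= => tT [x /=]; rewrite in_itv/= => x01 E.
move=> s /andP[s0 sd].
have z0 : 0 <= (0 : R) <= T by rewrite lexx (ltW T_gt0).
have [|c cT <-] := @ivt_itv R 0 T (rho^~ x) t 0 s (rho_cont_t x01) tT z0.
  by rewrite E s0 (le_trans sd)//; case/andP: (rho_init x01).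
exact: in_range.
Qed.

Lemma range_near_alpha : Rg alpha ->
  forall s, alpha - delta <= s <= alpha -> Rg s.
Proof.
move=> [t /=]; rewrite in_itv/= => tT [x /=]; rewrite in_itv/= => x01 E.
move=> s /andP[s0 sd].
have z0 : 0 <= (0 : R) <= T by rewrite lexx (ltW T_gt0).
have [|c cT <-] := @ivt_itv R 0 T (rho^~ x) 0 t s (rho_cont_t x01) z0 tT.
  by rewrite E sd andbT (le_trans _ s0)//; case/andP: (rho_init x01).
exact: in_range.
Qed.

Lemma range_sub s : Rg s -> 0 <= s <= alpha.
Proof.
move=> [t /=]; rewrite in_itv/= => tT [x /=]; rewrite in_itv/= => x01 <-.
exact: rho_range.
Qed.

Variables (U : R -> R) (gamma K : R).
Hypothesis CU : Ck_in `]0, alpha[ 3 U.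
Hypothesis U_convex : forall s : R, 0 < s < alpha -> 0 <= derive1n 2 U s.
Hypothesis HU : holder_norm_le Rg 3 gamma U K.

Local Notation dU := (deriv_in `[0, alpha] U).

Lemma alpha_gt0 : 0 < alpha.
Proof.
have := rho_init (x := 0); rewrite lexx ler01 => /(_ isT).
by move: delta_gt0; lra.
Qed.

(** At interior points both derivatives exist and limits along the range are
unique; at an endpoint the range is a one-sided neighbourhood. *)
Lemma dU_range s : (forall y, Rg y -> forall e : R, 0 < e ->
    exists z, Rg z /\ 0 < `|z - y| < e) -> Rg s ->
  dU s = derivn_in Rg 1 U s.
Proof.
move=> lim Rs; have sa := range_sub Rs.
have a0 := alpha_gt0; have d0 := delta_gt0.
have DR : diff_in Rg U s (derivn_in Rg 1 U s) :=
  holder_norm_diff_in (j := 0) HU isT Rs.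
have lim0a := itv_limit_point a0 sa.
have [s0|s0] := eqVneq s 0.
  apply: (diff_in_deriv_in lim0a).
  apply: (diff_in_near delta_gt0 _ DR) => y.
  rewrite s0 subr0 /= in_itv/= => yd ya.
  apply: range_near0; first by rewrite -s0.
  by move: yd; rewrite ltr_norml; lra.
have [sE|sNa] := eqVneq s alpha.
  apply: (diff_in_deriv_in lim0a).
  apply: (diff_in_near delta_gt0 _ DR) => y; rewrite sE /= in_itv/= => yd ya.
  apply: range_near_alpha; first by rewrite -sE.
  by move: yd; rewrite ltr_norml; lra.
have si : 0 < s < alpha by rewrite !lt_neqAle eq_sym s0 sNa.
have sI : `]0, alpha[%classic s by rewrite itvooE.
have D := Ck_in_diff_in (j := 0) CU isT sI.
have r0 : 0 < Num.min s (alpha - s) by rewrite lt_min; lra.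
have D' : diff_in `[0, alpha] U s (derivn_in `]0, alpha[ 1 U s).
  apply: (diff_in_near r0 _ D) => y; rewrite lt_min !ltr_norml itvooE; lra.
rewrite (diff_in_deriv_in lim0a D').
apply: (diff_in_uniq (lim s Rs) _ DR).
apply: (diff_in_sub _ D') => y /range_sub.
by rewrite /= in_itv.
Qed.

(** For comparing the scheme, whose values lie in ]0, alpha[, with the exact
solution, which may reach 0 or alpha. If the solution is constant, its value
lies in the interior. *)
Lemma dU_range_monotone p q : 0 < p < alpha -> Rg q ->
  (p <= q -> dU p <= dU q) /\ (q <= p -> dU q <= dU p).
Proof.
move=> pa Rq; have qa := range_sub Rq.
have a0 := alpha_gt0; have d0 := delta_gt0.
have [z0 z1] : 0 <= (0 : R) <= T /\ 0 <= (0 : R) <= 1.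
  by rewrite !lexx ler01 (ltW T_gt0).
have [q0|q0] := eqVneq q 0.
- split=> [|_]; first by rewrite q0; lra.
  have [const|lim] := range_dichotomy.
    have := range_near0; rewrite -q0 => /(_ Rq delta).
    rewrite q0 lexx (ltW delta_gt0).
    case=> // t /=; rewrite in_itv/= => tT [x /=]; rewrite in_itv/= => x01.
    move: Rq; rewrite q0 => -[t' /=]; rewrite in_itv/= => tT' [x' /=].
    rewrite in_itv/= => x01'.
    by rewrite !const// => ->; lra.
  rewrite q0 in Rq *.
  have D : diff_in Rg dU 0 (derivn_in Rg 2 U 0).
    apply: (@diff_in_eq _ _ (derivn_in Rg 1 U)) => //.
      by move=> y Ry; rewrite dU_range.
    exact: holder_norm_diff_in HU _ _.
  apply: (dU_monotone_left CU U_convex D) => // r r0.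
  exists (Num.min delta (r / 2)).
    by apply: range_near0 => //; rewrite ge_min le_min lexx; lra.
  by rewrite lt_min gt_min; apply/andP; split; [|apply/orP; right]; lra.
have [qE|qNa] := eqVneq q alpha.
- split=> [_|]; last by rewrite qE; lra.
  have [const|lim] := range_dichotomy.
    have := range_near_alpha; rewrite -qE => /(_ Rq (q - delta)).
    rewrite lexx gerBl (ltW delta_gt0).
    case=> // t /=; rewrite in_itv/= => tT [x /=]; rewrite in_itv/= => x01.
    move: Rq => -[t' /=]; rewrite in_itv/= => tT' [x' /=].
    rewrite in_itv/= => x01'.
    by rewrite !const// => ->; lra.
  rewrite qE in Rq *.
  have D : diff_in Rg dU alpha (derivn_in Rg 2 U alpha).
    apply: (@diff_in_eq _ _ (derivn_in Rg 1 U)) => //.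
      by move=> y Ry; rewrite dU_range.
    exact: holder_norm_diff_in HU _ _.
  apply: (dU_monotone_right CU U_convex D) => // r r0.
  exists (Num.max (alpha - delta) (alpha - r / 2)).
    by apply: range_near_alpha => //; rewrite le_max ge_max lexx; lra.
  by rewrite gt_max lt_max; apply/andP; split; [apply/orP; right|]; lra.
have qi : 0 < q < alpha by rewrite !lt_neqAle eq_sym q0 qNa.
by split=> ?; apply: (dU_monotone CU U_convex); lra.
Qed.

End range_of_solution.

(** * The error estimate *)

Section convergence.
Variables (R : realType) (alpha : R) (m V U : R -> R) (s0 : R)
    (m1 m2 : R -> R) (beta gamma T : R) (rho0 : R -> R) (rho : R -> R -> R).
Hypothesis hstanding : standing_assumptions alpha m V U s0.
Hypothesis hdecomp : mobility_decomposition alpha m m1 m2.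
Hypothesis hbeta : 0 < beta <= 1.
Hypothesis hgamma : 0 < gamma <= 1.
Hypothesis hT : 0 < T.
Hypothesis hrho0 : A_plus alpha rho0.
Hypothesis hrho : classical_solution alpha m V U rho0 T rho.
Let Rg := [set rho t x | t in `[0, T] & x in `[0, 1]].
Hypothesis hU : Ck_holder Rg 3 gamma U.
Hypothesis hm1 : Ck_holder Rg 1 gamma m1.
Hypothesis hm2 : Ck_holder Rg 1 gamma m2.
Hypothesis hV : Ck_holder `[0, 1] 2 gamma V.
Hypothesis hrho_t : exists K, forall x, 0 <= x <= 1 ->
  holder_norm_le `[0, T] 1 beta (rho^~ x) K.
Hypothesis hrho_x : exists K, forall t, 0 <= t <= T ->
  holder_norm_le `[0, 1] 2 gamma (rho t) K.

Let S : set R := [set t | 0 <= t <= T].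

Let rx t := derivn_in `[0, 1] 1 (rho t).
Let rxx t := derivn_in `[0, 1] 2 (rho t).

Let rhoP t x : S t -> 0 <= x <= 1 -> Rg (rho t x).
Proof. exact: in_range. Qed.

Let D_rho : unif_diff S rho rx.
Proof.
by have [K HK] := hrho_x => t St; apply: (holder_normP (j := 0) (HK t St)).
Qed.

Let D_rx : unif_diff S rx rxx.
Proof.
by have [K HK] := hrho_x => t St; apply: (holder_normP (j := 1) (HK t St)).
Qed.

Let H_rxx : unif_holder S gamma rxx.
Proof.
have [K HK] := hrho_x; exists K => t St; split=> [x x01|x y x01 y01].
  by apply: (holder_norm_bound (HK t St)); rewrite /= ?in_itv.
by apply: (holder_norm_top (HK t St)); rewrite /= in_itv.
Qed.

Let rx_bounded : exists K, forall t x, S t -> 0 <= x <= 1 -> `|rx t x| <= K.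
Proof.
have [K HK] := hrho_x; exists K => t x St x01.
by apply: (holder_norm_bound (HK t St)); rewrite /= ?in_itv.
Qed.

Let H_rx : unif_holder S gamma rx.
Proof.
have [K HK] := rx_bounded; have [L HL] := H_rxx.
apply: (unif_holder_of_diff hgamma D_rx HK) => t x St; exact: (HL t St).1.
Qed.

Let rho_lip : exists L, forall t x y, S t -> 0 <= x <= 1 -> 0 <= y <= 1 ->
  `|rho t x - rho t y| <= L * `|x - y|.
Proof.
have [L HL] := rx_bounded; exists L => t x y St x01 y01.
by apply: (lip_of_bounded (D_rho St)) => // z; exact: HL.
Qed.

Lemma unif_C1_comp (phi phi1 : R -> R) (K : R) :
  (forall s, Rg s -> diff_in Rg phi s (phi1 s)) ->
  (forall s, Rg s -> `|phi s| <= K) -> (forall s, Rg s -> `|phi1 s| <= K) ->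
  (forall s s', Rg s -> Rg s' ->
     `|phi1 s - phi1 s'| <= K * `|s - s'| `^ gamma) ->
  [/\ unif_diff S (fun t x => phi (rho t x))
                  (fun t x => phi1 (rho t x) * rx t x),
      unif_holder S gamma (fun t x => phi (rho t x))
    & unif_holder S gamma (fun t x => phi1 (rho t x) * rx t x)].
Proof.
move=> Dphi Kphi Kphi1 Hphi1; have [L HL] := rho_lip; have [B HB] := rx_bounded.
have D : unif_diff S (fun t x => phi (rho t x))
                     (fun t x => phi1 (rho t x) * rx t x).
  move=> t St x x01; apply: (@diff_in_comp _ _ Rg phi (rho t)).
  - by move=> y; rewrite /= in_itv/= => y01; exact: rhoP.
  - exact/Dphi/rhoP.
  - exact: D_rho.
split=> //.
- apply: (unif_holder_of_diff hgamma D (K := K) (L := K * B)) => t x St x01.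
    exact/Kphi/rhoP.
  by rewrite normrM ler_pM ?Kphi1 ?HB//; exact: rhoP.
- apply: unif_holderM H_rx.
  exact: (unif_holder_comp hgamma rhoP Kphi1 Hphi1 HL).
Qed.

Lemma unif_C1_holder f : Ck_holder Rg 1 gamma f ->
  exists f1, [/\ unif_diff S (fun t x => f (rho t x)) f1,
      unif_holder S gamma (fun t x => f (rho t x)) & unif_holder S gamma f1].
Proof.
move=> [K HK]; exists (fun t x => derivn_in Rg 1 f (rho t x) * rx t x).
apply: (@unif_C1_comp _ _ K).
- by move=> s Rs; apply: (holder_norm_diff_in (j := 0) HK).
- by move=> s Rs; apply: (holder_norm_bound (j := 0) HK).
- by move=> s Rs; apply: (holder_norm_bound (j := 1) HK).
- exact: holder_norm_top HK.
Qed.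

Let CU : Ck_in `]0, alpha[ 3 U.
Proof. by case: hstanding => _ _ [_ H _ _ _] _. Qed.

Let U_convex s : 0 < s < alpha -> 0 <= derive1n 2 U s.
Proof. by case: hstanding => _ _ [_ _ H _ _] _; exact: H. Qed.

Let rho_range t x : S t -> 0 <= x <= 1 -> 0 <= rho t x <= alpha.
Proof. by case: hrho => H _ _ _ _; exact: H. Qed.

Let D_rho_t x t : 0 <= x <= 1 -> S t ->
  diff_in `[0, T] (rho^~ x) t (derivn_in `[0, T] 1 (rho^~ x) t).
Proof.
move=> x01 St; have [K HK] := hrho_t.
by apply: (holder_norm_diff_in (j := 0) (HK x x01)); rewrite /= ?in_itv.
Qed.

Let rho_cont_t x : 0 <= x <= 1 -> {within `[0, T], continuous (rho^~ x)}.
Proof.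
move=> x01; apply: diff_in_cont => t; rewrite /= in_itv/= => tT.
exact: D_rho_t.
Qed.

Let rho_cont_x t : S t -> {within `[0, 1], continuous (rho t)}.
Proof.
move=> St; apply: diff_in_cont => x; rewrite /= in_itv/= => x01.
exact: D_rho.
Qed.

Let S0 : S 0. Proof. by rewrite /S/= lexx ltW. Qed.

Let rho_init : exists2 delta, 0 < delta &
  forall x, 0 <= x <= 1 -> delta <= rho 0 x <= alpha - delta.
Proof.
have [_ [delta d0 ae]] := hrho0; exists delta => //.
apply: (ae_bounds_closed (D_rho S0)).
have [_ _ _ _ ae'] := hrho.
have aeF : Filter (almost_everywhere (@lebesgue_measure R)) :=
  ae_filter_ringOfSetsType _.
apply: filterS2 ae ae' => x H H' x01; rewrite H'//; exact: H.
Qed.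

Local Notation dU := (deriv_in `[0, alpha] U).

Let dU_mono p q : 0 < p < alpha -> Rg q ->
  (p <= q -> dU p <= dU q) /\ (q <= p -> dU q <= dU p).
Proof.
have [delta d0 init] := rho_init; have [K HK] := hU.
exact: (dU_range_monotone hT rho_range rho_cont_t rho_cont_x d0 init
          CU U_convex HK).
Qed.

(** For a constant solution U'(rho) is constant, and the derivative of U relative
to the range, a single point, says nothing about U'; otherwise U' is the
derivative relative to the range and the chain rule applies twice. *)
Lemma unif_C2_potential : exists g1 g2,
  [/\ unif_diff S (potential alpha V U rho) g1, unif_diff S g1 g2,
      unif_holder S gamma g1 & unif_holder S gamma g2].
Proof.
have [KV HV] := hV.
have DV : unif_diff S (fun=> V) (fun=> derivn_in `[0, 1] 1 V).
  by move=> t _; apply: (holder_normP (j := 0) HV).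
have DV1 : unif_diff S (fun=> derivn_in `[0, 1] 1 V)
                       (fun=> derivn_in `[0, 1] 2 V).
  by move=> t _; apply: (holder_normP (j := 1) HV).
have HV2 : unif_holder S gamma (fun=> derivn_in `[0, 1] 2 V).
  exists KV => t _; split=> [x x01|x y x01 y01].
    by apply: (holder_norm_bound HV); rewrite /= ?in_itv.
  by apply: (holder_norm_top HV); rewrite /= in_itv.
have HV1 : unif_holder S gamma (fun=> derivn_in `[0, 1] 1 V).
  apply: (unif_holder_of_diff hgamma DV1 (K := KV) (L := KV)) => t x St x01;
    by apply: (holder_norm_bound HV); rewrite /= ?in_itv.
suff [P1 [P2 [D1 D2 H1 H2]]] : exists P1 P2,
    [/\ unif_diff S (fun t x => dU (rho t x)) P1, unif_diff S P1 P2,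
        unif_holder S gamma P1 & unif_holder S gamma P2].
  exists (fun t x => P1 t x + derivn_in `[0, 1] 1 V x).
  exists (fun t x => P2 t x + derivn_in `[0, 1] 2 V x).
  split; [| |exact: unif_holderD|exact: unif_holderD].
    by move=> t St x x01; apply: diff_inD; [exact: D1|exact: (DV t)].
  by move=> t St x x01; apply: diff_inD; [exact: D2|exact: (DV1 t)].
have [delta d0 init] := rho_init; have [K HK] := hU.
have [const|lim] := range_dichotomy hT rho_cont_t rho_cont_x.
  have H0 : unif_holder S gamma (fun _ _ => 0).
    exists 0 => t _; split=> [x _|x y _ _].
      by rewrite normr0.
    by rewrite subrr normr0 mul0r.
  exists (fun _ _ => 0), (fun _ _ => 0); split => //.
  - move=> t St x x01; apply: (@diff_in_eq _ _ (fun=> dU (rho 0 0))).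
    + by move=> y; rewrite /= in_itv/= => y01; rewrite const.
    + by rewrite /= in_itv.
    + exact: diff_in_cst.
  - by move=> t St x x01; exact: diff_in_cst.
have dUE s : Rg s -> dU s = derivn_in Rg 1 U s.
  exact: (dU_range hT rho_range rho_cont_t d0 init CU HK lim).
have K2 s : Rg s -> `|derivn_in Rg 2 U s| <= K by apply: holder_norm_bound HK _.
have K3 s : Rg s -> `|derivn_in Rg 3 U s| <= K by apply: holder_norm_bound HK _.
have [D2 H2 H32] := unif_C1_comp
  (fun s Rs => holder_norm_diff_in (j := 2) HK isT Rs) K2 K3
  (holder_norm_top HK).
exists (fun t x => derivn_in Rg 2 U (rho t x) * rx t x).
exists (fun t x => derivn_in Rg 3 U (rho t x) * rx t x * rx t x
                   + derivn_in Rg 2 U (rho t x) * rxx t x).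
split.
- move=> t St x x01; apply: (@diff_in_comp _ _ Rg dU (rho t)).
  + by move=> y; rewrite /= in_itv/= => y01; exact: rhoP.
  + have Rx := rhoP St x01; apply: (@diff_in_eq _ _ (derivn_in Rg 1 U)) => //.
      by move=> y Ry; rewrite dUE.
    exact: (holder_norm_diff_in (j := 1) HK isT Rx).
  + exact: D_rho.
- by move=> t St x x01; apply: diff_inM; [exact: D2|exact: D_rx].
- exact: unif_holderM.
- by apply: unif_holderD; apply: unif_holderM.
Qed.

Let m12 s : 0 <= s <= alpha -> m s = m1 s * m2 s.
Proof. by case: hdecomp => H _ _ _ _ sa; apply: H; rewrite /= in_itv. Qed.

Let a t x := m1 (rho t x).
Let b t x := m2 (rho t x).
Let g := potential alpha V U rho.
Let u dt N n i := rho (n%:R * dt) (Defs.center R N i).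

Lemma unif_profile : exists K a1 b1 g1 g2, forall t, S t ->
  [/\ diff_on01 (a t) (a1 t) /\ diff_on01 (b t) (b1 t),
      diff_on01 (g t) (g1 t) /\ diff_on01 (g1 t) (g2 t),
      holder_on gamma K (a t) /\ holder_on gamma K (b t),
      holder_on gamma K (a1 t) /\ holder_on gamma K (b1 t)
    & holder_on gamma K (g1 t) /\ holder_on gamma K (g2 t)].
Proof.
have [a1 [Da [Ka Ha] [Ka1 Ha1]]] := unif_C1_holder hm1.
have [b1 [Db [Kb Hb] [Kb1 Hb1]]] := unif_C1_holder hm2.
have [g1 [g2 [Dg Dg1 [Kg1 Hg1] [Kg2 Hg2]]]] := unif_C2_potential.
pose K := `|Ka| + `|Ka1| + `|Kb| + `|Kb1| + `|Kg1| + `|Kg2|.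
exists K, a1, b1, g1, g2 => t St.
have n (k : R) : 0 <= `|k| /\ k <= `|k|.
  by split; [exact: normr_ge0|exact: ler_norm].
have [? ?] := n Ka; have [? ?] := n Ka1.
have [? ?] := n Kb; have [? ?] := n Kb1.
have [? ?] := n Kg1; have [? ?] := n Kg2.
split; split; first [exact: Da|exact: Db|exact: Dg|exact: Dg1
  |apply: (holder_on_le _ (Ha t St)); rewrite /K; lra
  |apply: (holder_on_le _ (Ha1 t St)); rewrite /K; lra
  |apply: (holder_on_le _ (Hb t St)); rewrite /K; lra
  |apply: (holder_on_le _ (Hb1 t St)); rewrite /K; lra
  |apply: (holder_on_le _ (Hg1 t St)); rewrite /K; lra
  |apply: (holder_on_le _ (Hg2 t St)); rewrite /K; lra].
Qed.

Let flux_on01 t g1 : S t -> diff_on01 (g t) g1 -> forall x, 0 <= x <= 1 ->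
  pde_flux alpha m V U rho t x = a t x * b t x * g1 x.
Proof.
move=> St Dg x x01; rewrite /pde_flux (diff_on01_deriv_in Dg x01).
by rewrite m12//; exact: rho_range.
Qed.

(** Both sides are derivatives of quantities that the equation equates: the
density in time and the flux a b g1 in space. *)
Let pde_identity t x a1 b1 g1 g2 : 0 < t -> S t -> 0 < x < 1 ->
  diff_on01 (a t) a1 -> diff_on01 (b t) b1 ->
  diff_on01 (g t) g1 -> diff_on01 g1 g2 ->
  derivn_in `[0, T] 1 (rho^~ x) t = flux_deriv (a t) a1 (b t) b1 g1 g2 x.
Proof.
move=> t0 St /andP[x0 x1] Da Db Dg Dg1.
have x01 : 0 <= x <= 1 by rewrite !ltW.
have [_ _ pde _ _] := hrho.
have [||l /has_deriv_inP Dl /has_deriv_inP Dl'] := pde t x.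
- by rewrite t0; case/andP: St.
- by rewrite x0.
rewrite [LHS](_ : _ = l); last first.
  by apply: diff_in_deriv_in Dl; exact: itv_limit_point.
apply: (diff_in_uniq (itv_limit_point ltr01 x01) Dl').
apply: (@diff_in_eq _ _ (fun y => a t y * b t y * g1 y)).
- by move=> y; rewrite /= in_itv/= => y01; rewrite (flux_on01 St Dg).
- by rewrite /= in_itv.
- by apply: diff_inM; [apply: diff_inM; [exact: Da|exact: Db]|exact: Dg1].
Qed.

Let time_increment : exists K, 0 <= K /\ forall t dt x, 0 < dt -> 0 <= t - dt ->
  t <= T -> 0 <= x <= 1 ->
  `|(rho t x - rho (t - dt) x) / dt - derivn_in `[0, T] 1 (rho^~ x) t|
  <= K * dt `^ beta.
Proof.
have [K HK] := hrho_t.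
have K0 : 0 <= K.
  apply: le_trans (holder_norm_bound (HK 0 _) (leq0n 1)
                                     (_ : `[0, T]%classic 0)).
  - exact: normr_ge0.
  - by rewrite lexx ler01.
  - by rewrite /= in_itv/= lexx ltW.
exists K; split=> // t dt x dt0 tdt tT x01.
have [|s st|c ct E] := @diff_in_MVT _ (t - dt) t (rho^~ x)
    (derivn_in `[0, T] 1 (rho^~ x)); first lra.
  apply: (@diff_in_sub _ `[0, T]).
    by move=> y; rewrite /= !in_itv/=; lra.
  by apply: D_rho_t => //; rewrite /S/=; lra.
rewrite E (_ : t - (t - dt) = dt); last by ring.
rewrite mulfK ?gt_eqF//.
have [ci ti] : `[0, T]%classic c /\ `[0, T]%classic t.
  by rewrite /= !in_itv/=; lra.
rewrite (le_trans (holder_norm_top (HK x x01) ci ti))// ler_wpM2l//.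
have [b0 _] := andP hbeta.
rewrite ge0_ler_powR ?nnegrE ?(ltW b0) ?(ltW dt0)//.
by rewrite ler_norml; lra.
Qed.

Let center01 N i : (1 <= i <= N)%N -> 0 < Defs.center R N i < 1.
Proof.
move=> /andP[i1 iN]; have N0 : (0 < N)%N by apply: leq_trans iN.
have h0 : 0 < dx R N by rewrite invr_gt0 ltr0n.
have Nh : N%:R * dx R N = 1 by rewrite mulfV// pnatr_eq0 -lt0n.
have hN : i%:R * dx R N <= 1 by rewrite -[leRHS]Nh ler_wpM2r ?ler_nat// ltW.
have hi : dx R N <= i%:R * dx R N by rewrite ler_peMl ?ler1n// ltW.
by rewrite /Defs.center mulrBl; lra.
Qed.

Let exact_flux dt N n i :=
  cell_flux (a (n%:R * dt)) (b (n%:R * dt)) (g (n%:R * dt)) N i.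

(** The residual of the exact solution in the scheme: the error of the difference
quotient in time plus that of the fluxes, both compared with the common value
of the two sides of the equation. *)
Lemma truncation_bound : exists C, 0 <= C /\ forall N dt n i,
  (0 < N)%N -> 0 < dt -> n.+1%:R * dt <= T -> (1 <= i <= N)%N ->
  `|(u dt N n.+1 i - u dt N n i) / dt
    + (exact_flux dt N n.+1 i - exact_flux dt N n.+1 i.-1) / dx R N|
  <= C * (dt `^ beta + dx R N `^ gamma + (i == 1%N)%:R + (i == N)%:R).
Proof.
have [K [a1 [b1 [g1 [g2 prof]]]]] := unif_profile.
have [L [L0 HL]] := time_increment.
have K0 : 0 <= K by have [_ _ [/holder_bound_ge0]] := prof 0 S0.
have K3 : 0 <= K * K * K by rewrite !mulr_ge0.
exists (L + 21 * (K * K * K)); split; first by rewrite addr_ge0// mulr_ge0.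
move=> N dt n i N0 dt0 tT iN; pose t := n.+1%:R * dt; have x01 := center01 iN.
have t0 : 0 < t by rewrite mulr_gt0.
have St : S t by rewrite /S/= ltW.
have [[Da Db] [Dg Dg1] [Ha Hb] [Ha1 Hb1] [Hg1 Hg2]] := prof t St.
have [_ _ _ noflux _] := hrho.
have [|bd0 bd1] := noflux t; first by rewrite t0.
rewrite (flux_on01 St Dg) ?lexx ?ler01// in bd0.
rewrite (flux_on01 St Dg) ?lexx ?ler01// in bd1.
have := truncation_error hgamma Da Db Dg Dg1 Ha Hb Ha1 Hb1 Hg1 Hg2
  N0 iN bd0 bd1.
set F := (_ - _) / _; rewrite -(pde_identity t0 St x01 Da Db Dg Dg1) => T1.
have x01' : 0 <= Defs.center R N i <= 1 by move/andP: x01 => [/ltW-> /ltW->].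
have tdt : t - dt = n%:R * dt by rewrite /t -natr1; ring.
have := HL t dt _ dt0 _ tT x01'; rewrite tdt mulr_ge0 ?ler0n ?(ltW dt0)//.
rewrite /u -/t => /(_ isT) T2.
set D := derivn_in _ _ _ _ in T1 T2; set Q := _ / dt in T2 *.
have -> : Q + F = (Q - D) + (F + D) by ring.
rewrite (le_trans (ler_normD _ _))// (le_trans (lerD T2 T1))//.
have := powR_ge0 dt beta; have := powR_ge0 (dx R N) gamma.
have : 0 <= (i == 1%N)%:R :> R by []; have : 0 <= (i == N)%:R :> R by [].
set p := dt `^ beta; set q := dx R N `^ gamma.
set y := (_ == 1%N)%:R; set z := (_ == N)%:R.
nra.
Qed.


Let u_range dt N n i : 0 < dt -> n%:R * dt <= T -> (1 <= i <= N)%N ->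
  Rg (u dt N n i).
Proof.
move=> dt0 tT /center01/andP[x0 x1]; apply: rhoP; last by rewrite !ltW.
by rewrite /S/= tT mulr_ge0// ltW.
Qed.

Let range_ord s : Rg s -> 0 <= s <= alpha.
Proof. exact: (range_sub rho_range). Qed.

Let mono_m1 p q : 0 <= p -> p <= q -> q <= alpha -> 0 <= m1 p <= m1 q.
Proof.
case: hdecomp => _ pos _ mono _ p0 pq qa.
have [pI qI] : `[0, alpha]%classic p /\ `[0, alpha]%classic q.
  by rewrite /= !in_itv/=; lra.
by rewrite (pos _ pI).1 mono.
Qed.

Let mono_m2 p q : 0 <= p -> p <= q -> q <= alpha -> 0 <= m2 q <= m2 p.
Proof.
case: hdecomp => _ pos _ _ mono p0 pq qa.
have [pI qI] : `[0, alpha]%classic p /\ `[0, alpha]%classic q.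
  by rewrite /= !in_itv/=; lra.
by rewrite (pos _ qI).2 mono.
Qed.

Section one_scheme.
Variables (N : nat) (dt : R) (r : nat -> nat -> R).
Hypothesis N_gt0 : (0 < N)%N.
Hypothesis dt_gt0 : 0 < dt.
Hypothesis hr : scheme_solution alpha V U m1 m2 N dt rho0 r.

Let h := dx R N.
Let h_gt0 : 0 < h. Proof. by rewrite invr_gt0 ltr0n. Qed.

Let w n i := r n i - u dt N n i.
Let G n i := num_flux V U m1 m2 N (r n) i - exact_flux dt N n i.

Let r_in n i : (1 <= i <= N)%N -> 0 < r n i < alpha.
Proof. by move=> /hr[]. Qed.

Let num_fluxE n i : (1 <= i < N)%N -> num_flux V U m1 m2 N (r n) i =
  upwind (m1 (r n i)) (m2 (r n i.+1)) (m1 (r n i.+1)) (m2 (r n i))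
    (- (dU (r n i.+1) + V (Defs.center R N i.+1)
        - (dU (r n i) + V (Defs.center R N i))) / h).
Proof.
move=> /andP[i1 iN]; rewrite /num_flux (ltn_eqF iN) -[i == 0%N]negbK -lt0n i1/=.
by rewrite /velocity /xi !dU_interior ?r_in// ?i1 ?(ltnW iN)// andbT.
Qed.

Let exact_fluxE n i : (1 <= i < N)%N -> exact_flux dt N n i =
  upwind (m1 (u dt N n i)) (m2 (u dt N n i.+1))
    (m1 (u dt N n i.+1)) (m2 (u dt N n i))
    (- (dU (u dt N n i.+1) + V (Defs.center R N i.+1)
        - (dU (u dt N n i) + V (Defs.center R N i))) / h).
Proof.
move=> /andP[i1 iN].
rewrite /exact_flux /cell_flux (ltn_eqF iN) -[i == 0%N]negbK -lt0n i1/=.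
have E : Defs.center R N i + dx R N = Defs.center R N i.+1.
  by rewrite /Defs.center -natr1; ring.
by rewrite /grid_flux /slope E.
Qed.

(** The sign of the error in a cell orders the mobilities and the value of U' in
that cell, so [upwind_le] compares the numerical and the exact flux. *)
Let flux_ordered n i : n%:R * dt <= T -> (1 <= i < N)%N ->
  (w n i.+1 <= 0 <= w n i -> 0 <= G n i) /\
  (w n i <= 0 <= w n i.+1 -> G n i <= 0).
Proof.
move=> tT iN; have /andP[i1 iN'] := iN.
have ii : (1 <= i <= N)%N by rewrite i1 ltnW.
have iS : (1 <= i.+1 <= N)%N by [].
have Ri := u_range dt_gt0 tT ii; have RS := u_range dt_gt0 tT iS.
have ri := r_in n ii; have rS := r_in n iS.
have ua := range_ord Ri; have ub := range_ord RS.
have [mi mi'] := dU_mono ri Ri; have [mS mS'] := dU_mono rS RS.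
have hV0 : 0 <= h^-1 by rewrite invr_ge0 ltW.
rewrite /w /G num_fluxE// exact_fluxE//; move: ri rS ua ub mi mi' mS mS'.
set p := r n i; set q := r n i.+1.
set p' := u dt N n i; set q' := u dt N n i.+1.
move=> ri rS ua ub mi mi' mS mS'; split=> /andP[w1 w2].
- rewrite subr_ge0; apply: upwind_le.
  + by apply: mono_m1; lra.
  + by apply: mono_m2; lra.
  + by apply: mono_m1; lra.
  + by apply: mono_m2; lra.
  + apply: ler_wpM2r => //.
    by have := mi' ltac:(lra); have := mS ltac:(lra); lra.
- rewrite subr_le0; apply: upwind_le.
  + by apply: mono_m1; lra.
  + by apply: mono_m2; lra.
  + by apply: mono_m1; lra.
  + by apply: mono_m2; lra.
  + apply: ler_wpM2r => //.
    by have := mi ltac:(lra); have := mS' ltac:(lra); lra.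
Qed.

Lemma error_step n : n.+1%:R * dt <= T ->
  \sum_(1 <= i < N.+1) `|w n.+1 i| <= \sum_(1 <= i < N.+1) `|w n i|
    + dt * \sum_(1 <= i < N.+1)
        `|(u dt N n.+1 i - u dt N n i) / dt
          + (exact_flux dt N n.+1 i - exact_flux dt N n.+1 i.-1) / h|.
Proof.
move=> tT; apply: (@abs_sum_contraction _ N (dt / h) dt _ _ (G n.+1)).
- by rewrite divr_ge0 ?ltW.
- exact: ltW.
- by rewrite /G /num_flux /exact_flux /cell_flux/= subrr.
- by rewrite /G /num_flux /exact_flux /cell_flux eqxx orbT subrr.
- by move=> i iN; case: (flux_ordered tT iN).
- by move=> i iN; case: (flux_ordered tT iN).
- move=> i iN; have [_ _ /(_ n) E] := hr iN.
  have {}E : r n.+1 i = r n i - dt / h *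
     (num_flux V U m1 m2 N (r n.+1) i - num_flux V U m1 m2 N (r n.+1) i.-1).
    move/(canRL (divfK (lt0r_neq0 dt_gt0)))/(canRL (subrK _)): E => ->.
    by rewrite /h; ring.
  by rewrite /w /G E; field; rewrite !gt_eqF.
Qed.

Let Nh : N%:R * h = 1. Proof. by rewrite mulfV// pnatr_eq0 -lt0n. Qed.

Let L1_errorE n : L1_error N dt rho r n = h * \sum_(1 <= i < N.+1) `|w n i|.
Proof. by []. Qed.

(** The cell average of the initial datum and its value at the centre differ by
at most the oscillation over the cell. *)
Lemma initial_error L :
  (forall x y, 0 <= x <= 1 -> 0 <= y <= 1 ->
    `|rho 0 x - rho 0 y| <= L * `|x - y|) ->
  L1_error N dt rho r 0 <= L * h.
Proof.
move=> HL; rewrite L1_errorE.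
have L0 : 0 <= L.
  have := HL 0 1; rewrite !lexx !ler01 sub0r normrN normr1 mulr1.
  by move=> /(_ isT isT); exact: le_trans.
have wi i : (1 <= i <= N)%N -> `|w 0 i| <= L * h.
  move=> iN; have [E _ _] := hr iN; have /andP[i1 iN'] := iN.
  have /andP[x0 x1] := center01 iN.
  rewrite /w /u E mul0r /cell_average -/h; set x := Defs.center R N i.
  set p := interface R N i.-1; set q := interface R N i.
  have qp : q - p = h.
    rewrite /p /q /interface -/h -mulrBl -[i in i%:R - _](prednK i1).
    by rewrite -natr1 addrAC subrr add0r mul1r.
  have p0 : 0 <= p by rewrite mulr_ge0// ltW.
  have q1 : q <= 1 by rewrite -[leRHS]Nh ler_wpM2r ?ler_nat// ltW.
  have xE : x = q - h / 2 by rewrite /x /q /Defs.center /interface -/h; ring.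
  have pq : p < q by rewrite -subr_gt0 qp.
  have sub : `]p, q[ `<=` `]0, 1[ by move=> y; rewrite /= !in_itv/=; lra.
  have intf : (@lebesgue_measure R).-integrable `]p, q[ (EFin \o rho0).
    have [int _] := hrho0.
    move: int; rewrite /L1_on; apply: integrableS => //; exact: measurable_itv.
  have [_ _ _ _ ae] := hrho.
  have ae' : {ae @lebesgue_measure R, forall y, p < y < q ->
      `|rho0 y - rho 0 x| <= L * h}.
    have aeF : Filter (almost_everywhere (@lebesgue_measure R)) :=
      ae_filter_ringOfSetsType _.
    apply: filterS ae => y Ey ypq; rewrite -Ey; last by lra.
    rewrite (le_trans (HL _ _ _ _)) ?ler_wpM2l//; try lra.
    by rewrite ler_norml; move: h_gt0; lra.
  have := Rintegral_near_cst pq intf ae'; rewrite qp => B.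
  rewrite -(ler_pM2r h_gt0) -[X in _ * X <= _](gtr0_norm h_gt0) -normrM mulrBl.
  by rewrite mulrAC mulVf ?gt_eqF// mul1r.
rewrite -[leRHS]mul1r -Nh -mulrA mulrCA ler_wpM2l ?(ltW h_gt0)//.
rewrite -{2}[N]subn0 -[(N - 0)%N]/((N.+1 - 1)%N) mulr_natl -sumr_const_nat.
by rewrite !big_nat; apply: ler_sum => i; rewrite ltnS => /wi.
Qed.

End one_scheme.

Lemma sum_indicator_le1 (N k : nat) :
  \sum_(1 <= i < N.+1) (i == k)%:R <= 1 :> R.
Proof.
rewrite -natr_sum (_ : \sum_(1 <= i < N.+1) (i == k) =
  count (pred1 k) (index_iota 1 N.+1))%N.
  by rewrite count_uniq_mem ?iota_uniq// lern1 leq_b1.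
by rewrite -sum1_count [RHS]big_mkcond; apply: eq_bigr => i _ /=; case: eqP.
Qed.

Lemma L1_error_bound : exists C, 0 <= C /\ forall N dt r n,
  (0 < N)%N -> 0 < dt -> scheme_solution alpha V U m1 m2 N dt rho0 r ->
  n%:R * dt <= T ->
  L1_error N dt rho r n <= C * (dt `^ beta + dx R N `^ gamma).
Proof.
have [C [C0 HC]] := truncation_bound; have [L HL] := rho_lip.
exists (`|L| + 3 * C * T); split; first by rewrite addr_ge0// !mulr_ge0// ltW.
move=> N dt r n N0 dt0 hr nT.
have h0 : 0 < dx R N by rewrite invr_gt0 ltr0n.
have h1 : dx R N <= 1 by rewrite invf_le1 ?ltr0n// ler1n.
have Nh : N%:R * dx R N = 1 by rewrite mulfV// pnatr_eq0 -lt0n.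
set A := dt `^ beta + _.
have hA : dx R N <= dx R N `^ gamma by apply: le_powR_unit; rewrite ?h0.
have bA := powR_ge0 dt beta.
have hA' : dx R N <= A by rewrite /A; lra.
have step k : k.+1%:R * dt <= T -> L1_error N dt rho r k.+1 <=
    L1_error N dt rho r k + dt * (3 * C * A).
  move=> kT; rewrite /L1_error.
  have := error_step N0 dt0 hr kT.
  move/(ler_wpM2l (ltW h0)) => /le_trans; apply; rewrite mulrDr lerD2l mulrCA.
  rewrite ler_wpM2l ?(ltW dt0)//.
  apply: (@le_trans _ _ (dx R N * \sum_(1 <= i < N.+1)
      C * (A + (i == 1%N)%:R + (i == N)%:R))).
    rewrite ler_wpM2l ?(ltW h0)// !big_nat; apply: ler_sum => i.
    rewrite ltnS => iN.
    exact: HC.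
  move: (A) hA' => B hB.
  rewrite -mulr_sumr !big_split/= sumr_const_nat subn1/= -[B *+ N]mulr_natl.
  have := sum_indicator_le1 N 1; have := sum_indicator_le1 N N.
  set s1 := \sum_(_ <= _ < _) _; set s2 := \sum_(_ <= _ < _) _ => s1le s2le.
  rewrite mulrCA (_ : 3 * C * B = C * (3 * B)); last by ring.
  rewrite ler_wpM2l// !mulrDr mulrA [_ * N%:R]mulrC Nh mul1r.
  have := ler_wpM2l (ltW h0) s1le; have := ler_wpM2l (ltW h0) s2le.
  by rewrite !mulr1; lra.
have ind k : k%:R * dt <= T ->
    L1_error N dt rho r k <= `|L| * dx R N + k%:R * dt * (3 * C * A).
  elim: k => [_|k IH kT].
    rewrite !mul0r addr0; apply: (initial_error N0 hr) => x y x01 y01.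
    by rewrite (le_trans (HL 0 x y S0 x01 y01))// ler_wpM2r// ler_norm.
  have kT' : k%:R * dt <= T.
    by rewrite (le_trans _ kT)// ler_wpM2r ?ler_nat// ltW.
  rewrite (le_trans (step k kT))// (le_trans (lerD (IH kT') (lexx _)))//.
  by rewrite -natr1 le_eqVlt; apply/orP; left; apply/eqP; ring.
rewrite (le_trans (ind n nT))// [leRHS]mulrDl lerD ?ler_wpM2l//.
have A0 : 0 <= A by rewrite (le_trans (ltW h0)).
have := ler_wpM2r (mulr_ge0 (mulr_ge0 (ler0n R 3) C0) A0) nT; lra.
Qed.

End convergence.

Theorem theorem2p14 (R : realType) (alpha : R) (m V U : R -> R) (s0 : R)
    (m1 m2 : R -> R) (beta gamma T : R) (rho0 : R -> R) (rho : R -> R -> R)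
    (hstanding : standing_assumptions alpha m V U s0)
    (hdecomp : mobility_decomposition alpha m m1 m2)
    (hbeta : 0 < beta <= 1) (hgamma : 0 < gamma <= 1) (hT : 0 < T)
    (hrho0 : A_plus alpha rho0)
    (hrho : classical_solution alpha m V U rho0 T rho)
    (range_rho := [set rho t x | t in `[0, T] & x in `[0, 1]])
    (hU : Ck_holder range_rho 3 gamma U)
    (hm1 : Ck_holder range_rho 1 gamma m1)
    (hm2 : Ck_holder range_rho 1 gamma m2)
    (hV : Ck_holder `[0, 1] 2 gamma V)
    (hrho_t : exists K, forall x, 0 <= x <= 1 ->
       holder_norm_le `[0, T] 1 beta (rho^~ x) K)
    (hrho_x : exists K, forall t, 0 <= t <= T ->
       holder_norm_le `[0, 1] 2 gamma (rho t) K) :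
  (exists C : R, forall (N : nat) (dt : R) (r : nat -> nat -> R),
     (0 < N)%N -> 0 < dt ->
     scheme_solution alpha V U m1 m2 N dt rho0 r ->
     (sup_error N dt T rho r <= (C * (dt `^ beta + dx R N `^ gamma))%:E)%E) /\
  (forall eps : R, 0 < eps ->
     \forall dt \near 0^'+ & N \near \oo, forall r : nat -> nat -> R,
       scheme_solution alpha V U m1 m2 N dt rho0 r ->
       (sup_error N dt T rho r < eps%:E)%E).
Proof.
have [C [C0 HC]] := L1_error_bound hstanding hdecomp hbeta hgamma hT hrho0 hrho
  hU hm1 hm2 hV hrho_t hrho_x.
have sup N dt r : (0 < N)%N -> 0 < dt ->
    scheme_solution alpha V U m1 m2 N dt rho0 r ->
    (sup_error N dt T rho r <= (C * (dt `^ beta + dx R N `^ gamma))%:E)%E.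
  move=> N0 dt0 hr; apply: ge_ereal_sup => _ [n /= nT <-]; rewrite lee_fin.
  by apply: HC => //; rewrite -ler_pdivlMr.
split; first by exists C.
move=> eps eps0.
have C1 : 0 < C + 1 by rewrite ltr_wpDl.
(* [C] may vanish, so C + 1 is used; either power gets half of eps / (C + 1) *)
pose d := eps / (C + 1) / 2.
have d0 : 0 < d by rewrite !divr_gt0.
have [b0 _] := andP hbeta; have [g0 _] := andP hgamma.
have small p (x : R) : 0 < p -> 0 < x -> x < d `^ p^-1 -> x `^ p < d.
  move=> p0 x0 xd; have := gt0_ltr_powR p0 _ _ xd.
  rewrite !nnegrE (ltW x0) powR_ge0 => /(_ isT isT).
  by rewrite -powRrM mulVf ?gt_eqF// powRr1// ltW.
near=> dt N => r hr.
have dt0 : 0 < dt by near: dt; exact: nbhs_right_gt.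
have N0 : (0 < N)%N by near: N; exact: nbhs_infty_gt.
have dt1 : dt `^ beta < d.
  apply: small => //; near: dt; apply: nbhs_right_lt; exact: powR_gt0.
have N1 : dx R N `^ gamma < d.
  have t0 : 0 < d `^ gamma^-1 by exact: powR_gt0.
  apply: small => //; first by rewrite invr_gt0 ltr0n.
  rewrite /dx invf_plt ?posrE ?ltr0n//; near: N; exact: nbhs_infty_gtr.
rewrite (le_lt_trans (sup _ _ _ N0 dt0 hr))// lte_fin.
apply: (@le_lt_trans _ _ ((C + 1) * (dt `^ beta + dx R N `^ gamma))).
  by rewrite ler_wpM2r ?addr_ge0 ?powR_ge0// lerDl.
rewrite mulrC -ltr_pdivlMr// (splitr (eps / _)) -/d; lra.
Unshelve. all: by end_near. Qed.
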